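(* Let $X$, $d$, $r$, $\mathcal{L}$ and the refined data $\mathfrak{h}=(\mathcal{L},V_{X_1},V_{X_2},V_{X_3})$ be as described in the context, with spaces $K_{il}$. For any $i\ge 0$ and $l\ge 0$ with $i+l\le d$, let $\underline{d}:=(i,d-i-l,l)$, and let $\underline{d}'':=(i-1,d-i-l+1,l)$ if $i>0$. Then the following statements hold. 1. Let $i,l$ be positive integers with $i+l=d$. Let $\underline{d}':=(i-1,d-i-l+2,l-1)$. Let $V_{\underline{d}'}$ and $V_{\underline{d}''}$ be $(r+1)$-dimensional subspaces of $K_{i-1,l-1}$ and $K_{i-1,l}$, respectively, such that $\varphi_{\underline{d}',\underline{d}''}(V_{\underline{d}'})=V_{\underline{d}''}^{X_3^c,0}$ and $\varphi_{\underline{d}'',\underline{d}'}(V_{\underline{d}''})=V_{\underline{d}'}^{X_3,0}$. Set $\beta:=\dim V_{\underline{d}''}^{X_1,0}-\dim(V_{\underline{d}''}^{X_2^c,0}\oplus V_{\underline{d}''}^{X_3^c,0})$. Then for any linearly independent $u_1,\dots,u_\beta\in V_{\underline{d}''}^{X_1,0}$ such that $V_{\underline{d}''}^{X_1,0}=(V_{\underline{d}''}^{X_2^c,0}\oplus V_{\underline{d}''}^{X_3^c,0})\oplus\langle u_1,\dots,u_\beta\rangle$, and any $v_1,\dots,v_\beta\in K_{il}$ such that $\varphi_{\underline{d},\underline{d}''}(v_1)=u_1,\dots,\varphi_{\underline{d},\underline{d}''}(v_\beta)=u_\beta$, the subspace $V_{\underline{d}}:=\varphi_{\underline{d}',\underline{d}}(V_{\underline{d}'})+\langle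 v_1,\dots,v_\beta\rangle\subseteq K_{il}$ is $(r+1)$-dimensional, and $$\varphi_{\underline{d}',\underline{d}}(V_{\underline{d}'})=V_{\underline{d}}^{X_2,0},\quad \varphi_{\underline{d},\underline{d}'}(V_{\underline{d}})=V_{\underline{d}'}^{X_2^c,0},\quad \varphi_{\underline{d}'',\underline{d}}(V_{\underline{d}''})=V_{\underline{d}}^{X_1^c,0},\quad \varphi_{\underline{d},\underline{d}''}(V_{\underline{d}})=V_{\underline{d}''}^{X_1,0}.$$ 2. Let $i,l$ be positive integers with $i+l\le d-1$. Let $\underline{d}':=(i-1,d-i-l+2,l-1)$ and $\underline{d}''':=(i,d-i-l-1,l+1)$. Let $V_{\underline{d}'}$, $V_{\underline{d}''}$ and $V_{\underline{d}'''}$ be $(r+1)$-dimensional subspaces of $K_{i-1,l-1}$, $K_{i-1,l}$ and $K_{i,l+1}$, respectively, such that $\varphi_{\underline{d}',\underline{d}''}(V_{\underline{d}'})=V_{\underline{d}''}^{X_3^c,0}$, $\varphi_{\underline{d}'',\underline{d}'}(V_{\underline{d}''})=V_{\underline{d}'}^{X_3,0}$, $\varphi_{\underline{d}'',\underline{d}'''}(V_{\underline{d}''})=V_{\underline{d}'''}^{X_2,0}$ and $\varphi_{\underline{d}''',\underline{d}''}(V_{\underline{d}'''})=V_{\underline{d}''}^{X_2^c,0}$. Set $\beta:=\dim V_{\underline{d}''}^{X_1,0}-\dim(V_{\underline{d}''}^{X_2^c,0}\oplus V_{\underline{d}''}^{X_3^c,0})$. Then for any linearly independent $u_1,\dots,u_\beta\in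 V_{\underline{d}''}^{X_1,0}$ such that $V_{\underline{d}''}^{X_1,0}=(V_{\underline{d}''}^{X_2^c,0}\oplus V_{\underline{d}''}^{X_3^c,0})\oplus\langle u_1,\dots,u_\beta\rangle$, and any $v_1,\dots,v_\beta\in K_{il}$ such that $\varphi_{\underline{d},\underline{d}''}(v_1)=u_1,\dots,\varphi_{\underline{d},\underline{d}''}(v_\beta)=u_\beta$, the subspace $V_{\underline{d}}:=(\varphi_{\underline{d}',\underline{d}}(V_{\underline{d}'})+\varphi_{\underline{d}''',\underline{d}}(V_{\underline{d}'''}))+\langle v_1,\dots,v_\beta\rangle\subseteq K_{il}$ is $(r+1)$-dimensional, and $$\varphi_{\underline{d}',\underline{d}}(V_{\underline{d}'})=V_{\underline{d}}^{X_2,0},\quad \varphi_{\underline{d},\underline{d}'}(V_{\underline{d}})=V_{\underline{d}'}^{X_2^c,0},\quad \varphi_{\underline{d}'',\underline{d}}(V_{\underline{d}''})=V_{\underline{d}}^{X_1^c,0},\quad \varphi_{\underline{d},\underline{d}''}(V_{\underline{d}})=V_{\underline{d}''}^{X_1,0},$$ $$\varphi_{\underline{d}''',\underline{d}}(V_{\underline{d}'''})=V_{\underline{d}}^{X_3,0},\quad \varphi_{\underline{d},\underline{d}'''}(V_{\underline{d}})=V_{\underline{d}'''}^{X_3^c,0}.$$ 3. Let $0<i<d$ and $l=0$. Let $\underline{d}''':=(i,d-i-l-1,l+1)$. Let $V_{\underline{d}''}$ and $V_{\underline{d}'''}$ be $(r+1)$-dimensional subspaces of $K_{i-1,l}$ and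 $K_{i,l+1}$, respectively, such that $\varphi_{\underline{d}'',\underline{d}'''}(V_{\underline{d}''})=V_{\underline{d}'''}^{X_2,0}$ and $\varphi_{\underline{d}''',\underline{d}''}(V_{\underline{d}'''})=V_{\underline{d}''}^{X_2^c,0}$. Set $\beta:=\dim V_{\underline{d}''}^{X_1,0}-\dim(V_{\underline{d}''}^{X_2^c,0}\oplus V_{\underline{d}''}^{X_3^c,0})$. Then for any linearly independent $u_1,\dots,u_\beta\in V_{\underline{d}''}^{X_1,0}$ such that $V_{\underline{d}''}^{X_1,0}=(V_{\underline{d}''}^{X_2^c,0}\oplus V_{\underline{d}''}^{X_3^c,0})\oplus\langle u_1,\dots,u_\beta\rangle$, and any $v_1,\dots,v_\beta\in K_{il}$ such that $\varphi_{\underline{d},\underline{d}''}(v_1)=u_1,\dots,\varphi_{\underline{d},\underline{d}''}(v_\beta)=u_\beta$, the subspace $V_{\underline{d}}:=\varphi_{\underline{d}''',\underline{d}}(V_{\underline{d}'''})+\langle v_1,\dots,v_\beta\rangle\subseteq K_{il}$ is $(r+1)$-dimensional, and $$\varphi_{\underline{d}''',\underline{d}}(V_{\underline{d}'''})=V_{\underline{d}}^{X_3,0},\quad \varphi_{\underline{d},\underline{d}'''}(V_{\underline{d}})=V_{\underline{d}'''}^{X_3^c,0},\quad \varphi_{\underline{d}'',\underline{d}}(V_{\underline{d}''})=V_{\underline{d}}^{X_1^c,0},\quad \varphi_{\underline{d},\underline{d}''}(V_{\underline{d}})=V_{\underline{d}''}^{X_1,0}.$$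
   Context: Curves are projective over an algebraically closed field $k$. $X$ is the union of three smooth connected curves $X_1,X_2,X_3$, where $X_1,X_2$ meet transversally at a single point $A$, $X_2,X_3$ meet transversally at a single point $B\neq A$, and $X_1\cap X_3=\emptyset$. For a union $Y$ of some components of $X$, $Y^c$ is the union of the other components. Fix integers $d,r\ge 0$ and an invertible sheaf $\mathcal{L}$ on $X$ of degree $d$ on $X_1$ and degree $0$ on $X_2$ and $X_3$. For integers $i,l\ge 0$ with $i+l\le d$, and $\underline{d}=(i,d-i-l,l)$, let $\mathcal{L}_{\underline{d}}=\mathcal{L}_{il}$ be the invertible sheaf on $X$ with restrictions $\mathcal{L}|_{X_1}(-(d-i)A)$, $\mathcal{L}|_{X_2}((d-i)A-lB)$, $\mathcal{L}|_{X_3}(lB)$; it has multidegree $\underline{d}$. Put $\mathcal{L}_{X_1}=\mathcal{L}_{(d,0,0)}$, $\mathcal{L}_{X_2}=\mathcal{L}_{(0,d,0)}$, $\mathcal{L}_{X_3}=\mathcal{L}_{(0,0,d)}$. Maps. For $\underline{d}=(i,d-i-l,l)\ge\underline 0$ and $q\in\{1,2,3\}$ let $\widetilde{\underline{d}}$ be $(i-1,d-i-l+1,l)$ if $q=1$, $(i+1,d-i-l-2,l+1)$ if $q=2$, $(i,d-i-l+1,l-1)$ if $q=3$. Whenever $\widetilde{\underline{d}}\ge\underline 0$ there are natural maps $\varphi_{\underline{d},\widetilde{\underline{d}}}:\mathcal{L}_{\underline{d}}\to\mathcal{L}_{\underline{d}}|_{X_q^c}=\mathcal{L}_{\widetilde{\underline{d}}}|_{X_q^c}(-X_q\cap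 X_q^c)\hookrightarrow\mathcal{L}_{\widetilde{\underline{d}}}$ and $\varphi_{\widetilde{\underline{d}},\underline{d}}:\mathcal{L}_{\widetilde{\underline{d}}}\to\mathcal{L}_{\widetilde{\underline{d}}}|_{X_q}=\mathcal{L}_{\underline{d}}|_{X_q}(-X_q\cap X_q^c)\hookrightarrow\mathcal{L}_{\underline{d}}$ (restriction followed by inclusion, i.e. extension by zero); the same symbols denote the induced maps on global sections. For a subspace $V\subseteq H^0(X,\mathcal{L}_{\underline{d}})$ and a subcurve $Y$, $V^{Y,0}$ is the subspace of sections in $V$ vanishing on $Y$. Refined data $\mathfrak{h}$. $V_{X_q}\subseteq H^0(X,\mathcal{L}_{X_q})$ ($q=1,2,3$) are subspaces of dimension $r+1$ which are linked: the compositions of the maps $\varphi$ along the chains of multidegrees $(d,0,0),(d-1,1,0),\dots,(0,d,0)$ and $(0,d,0),(0,d-1,1),\dots,(0,0,d)$, in both directions, map $V_{X_1}$ into $V_{X_2}$, $V_{X_2}$ into $V_{X_1}$, $V_{X_2}$ into $V_{X_3}$ and $V_{X_3}$ into $V_{X_2}$. Restriction to $X_q$ is injective on $V_{X_q}$, and $V_{X_q}$ is also regarded as a linear series in $H^0(X_q,\mathcal{L}_{X_q}|_{X_q})$; for an effective divisor $D$ supported at the nodes on $X_q$, $V_{X_q}(-D)$ is the subspace of sections of this linear series vanishing along $D$. Let $a_0<\dots<a_r$ be the orders of vanishing of $V_{X_1}$ at $A$, $b_0<\dots<b_r$ and $b'_0<\dots<b'_r$ those of $V_{X_2}$ at $A$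 and at $B$, and $c_0<\dots<c_r$ those of $V_{X_3}$ at $B$. The associated Eisenbud–Harris limit linear series is assumed refined: $a_{r-j}+b_j=d$ and $b'_j+c_{r-j}=d$ for $0\le j\le r$. Kernels. Since $\mathcal{L}_{il}|_{X_1}=\mathcal{L}_{X_1}|_{X_1}(-(d-i)A)$, $\mathcal{L}_{il}|_{X_2}=\mathcal{L}_{X_2}|_{X_2}(-iA-lB)$, $\mathcal{L}_{il}|_{X_3}=\mathcal{L}_{X_3}|_{X_3}(-(d-l)B)$, one defines $K_{il}\subseteq H^0(X,\mathcal{L}_{il})$ (for $i,l\ge0$, $i+l\le d$) as the space of sections $s$ with $s|_{X_1}\in V_{X_1}(-(d-i)A)$, $s|_{X_2}\in V_{X_2}(-iA-lB)$ and $s|_{X_3}\in V_{X_3}(-(d-l)B)$. Equivalently, $K_{il}$ is the kernel of the evaluation (gluing) map $V_{X_1}(-(d-i)A)\oplus V_{X_2}(-iA-lB)\oplus V_{X_3}(-(d-l)B)\to k\oplus k$ at $A$ and $B$. *)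

(* Defs.v *)
(* MathComp with the classical sets of MathComp-Analysis; divisors are the
   free abelian groups of multinomials.

   Conventions.  A smooth connected projective curve over an algebraically
   closed field k is given by its function field K, its closed points being the
   normalized discrete valuations of K that are trivial on k (the abstract
   nonsingular curve of K/k).  An invertible sheaf on such a curve is O(D) for a
   divisor D, viewed as a subsheaf of the constant sheaf K.  An invertible sheaf
   on a nodal union of such curves is a Cartier divisor, viewed as a subsheaf of
   the sheaf of total quotient rings, so that its global sections are tuples of
   rational functions, one on each component. *)

From HB Require Import structures.
From mathcomp Require Import all_boot all_order all_algebra.
From mathcomp Require Import boolp classical_sets.
From mathcomp Require Import freeg.

Set Implicit Arguments.
Unset Strict Implicit.
Unset Printing Implicit Defensive.

Import Order.TTheory GRing.Theory Num.Theory.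

Local Open Scope classical_set_scope.
Local Open Scope ring_scope.

Section Subspaces.
Variables (k : fieldType) (M : lmodType k).
Implicit Types V W U : set M.

Definition lin_indep n (u : 'I_n -> M) : Prop :=
  forall c : 'I_n -> k, \sum_(j < n) c j *: u j = 0 -> forall j, c j = 0.

Definition lin_span n (u : 'I_n -> M) : set M :=
  [set x | exists c : 'I_n -> k, x = \sum_(j < n) c j *: u j].

(* V is a linear subspace of M of dimension n *)
Definition has_dim V (n : nat) : Prop :=
  exists e : 'I_n -> M, lin_indep e /\ V = lin_span e.

(* junk value 0 if V is not a finite-dimensional subspace *)
Definition dim V : nat := xget 0%N [set n | has_dim V n].

Definition sum_space V W : set M := [set v + w | v in V & w in W].

Definition is_direct_sum U V W : Prop :=
  U = sum_space V W /\ V `&` W = [set 0].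

End Subspaces.

#[short(type="fieldAlgType")]
HB.structure Definition FieldAlg (k : fieldType) :=
  { K of GRing.Field K & GRing.Algebra k K }.

Section Curves.
Variable k : closedFieldType.

(* K/k is finitely generated of transcendence degree 1: K is a finite extension
   of k(x) for some x transcendental over k. *)
Definition is_function_field (K : fieldAlgType k) : Prop :=
  exists x : K,
    (forall p : {poly k}, p != 0 -> (map_poly (in_alg K) p).[x] != 0) /\
    exists (n : nat) (e : 'I_n -> K), forall y : K,
    exists (q : {poly k}) (p : 'I_n -> {poly k}), q != 0 /\
      (map_poly (in_alg K) q).[x] * y
        = \sum_(j < n) (map_poly (in_alg K) (p j)).[x] * e j.

Record curve := Curve {
  fun_field : fieldAlgType k;
  fun_fieldP : is_function_field fun_field
}.

(* ord_at P 0 is set to 0 by convention *)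
Record closed_point (C : curve) := ClosedPoint {
  ord_at : fun_field C -> int;
  ord_at0 : ord_at 0 = 0;
  ord_atM : forall f g, f != 0 -> g != 0 -> ord_at (f * g) = ord_at f + ord_at g;
  ord_atD : forall f g, f != 0 -> g != 0 -> f + g != 0 ->
    Num.min (ord_at f) (ord_at g) <= ord_at (f + g);
  ord_atC : forall c : k, ord_at c%:A = 0;
  ord_at_norm : exists t, ord_at t = 1
}.

HB.instance Definition _ (C : curve) := gen_eqMixin (closed_point C).
HB.instance Definition _ (C : curve) := gen_choiceMixin (closed_point C).

Definition divisor (C : curve) := {freeg (closed_point C)}.

Section OneCurve.
Variable C : curve.
Local Notation K := (fun_field C).

(* f is regular at P with value c *)
Definition has_value (P : closed_point C) (f : K) (c : k) : Prop :=
  f - c%:A = 0 \/ 0 < ord_at P (f - c%:A).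

(* H^0(C, O(D)) *)
Definition H0_curve (D : divisor C) : set K :=
  [set f | f != 0 -> forall P, 0 <= ord_at P f + coeff P D].

(* g generates O(D) at P *)
Definition is_generator (P : closed_point C) (D : divisor C) (g : K) : Prop :=
  g != 0 /\ ord_at P g = - coeff P D.

(* orders of vanishing at P of a linear series W in H^0(C, O(D)) *)
Definition vanishing_orders (D : divisor C) (W : set K) (P : closed_point C) : set nat :=
  [set n | exists f, [/\ W f, f != 0 & ord_at P f + coeff P D = n%:Z]].

(* W(-E): the sections of a linear series W in H^0(C, O(D)) that vanish along
   the effective divisor E *)
Definition series_sub (D : divisor C) (W : set K) (E : divisor C) : set K :=
  W `&` H0_curve (D - E).

Lemma ord_at1 (P : closed_point C) : ord_at P 1 = 0.
Proof. by have := ord_atC P 1; rewrite scale1r. Qed.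

Lemma ord_atX (P : closed_point C) (t : K) n : t != 0 ->
  ord_at P (t ^+ n) = ord_at P t *+ n.
Proof.
move=> t0; elim: n => [|n IH]; first by rewrite expr0 ord_at1.
by rewrite exprS mulrS ord_atM ?IH ?expf_neq0.
Qed.

Lemma ord_atV (P : closed_point C) (t : K) : t != 0 -> ord_at P t^-1 = - ord_at P t.
Proof.
move=> t0; apply/eqP; rewrite -addr_eq0 addrC -ord_atM ?invr_eq0 //.
by rewrite divff // ord_at1.
Qed.

Lemma uniformizer_neq0 (P : closed_point C) (t : K) : ord_at P t = 1 -> t != 0.
Proof. by move=> h; apply/eqP => t0; move: h; rewrite t0 ord_at0. Qed.

Lemma generatorM (P : closed_point C) D E (g h : K) :
  is_generator P D g -> is_generator P E h -> is_generator P (D + E) (g * h).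
Proof.
by case=> g0 gP [h0 hP]; split; rewrite ?mulf_neq0 // ord_atM // gP hP coeffD opprD.
Qed.

Lemma generatorX (P : closed_point C) (t : K) n : ord_at P t = 1 ->
  is_generator P (- (<< P >> *+ n)) (t ^+ n).
Proof.
move=> tP; have t0 := uniformizer_neq0 tP; split; first by rewrite expf_neq0.
by rewrite ord_atX // tP coeffN coeffMn coeffU eqxx mulr1 opprK.
Qed.

Lemma generatorXN (P : closed_point C) (t : K) n : ord_at P t = 1 ->
  is_generator P (<< P >> *+ n) (t ^- n).
Proof.
move=> tP; have [t0 tnP] := generatorX n tP; split; first by rewrite invr_eq0.
by rewrite ord_atV // tnP coeffN opprK.
Qed.

Lemma generator_away (P Q : closed_point C) n : Q <> P ->
  is_generator Q (<< P >> *+ n) 1 /\ is_generator Q (- (<< P >> *+ n)) 1.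
Proof.
move=> /eqP QP; have PQ : (P == Q) = false by rewrite eq_sym; apply: negbTE.
by split; split; rewrite ?oner_eq0 // ord_at1 ?coeffN coeffMn coeffU PQ mulr0
  mul0rn ?oppr0.
Qed.

End OneCurve.

(* The nodal curve X obtained from X1, X2, X3 by gluing the point A1 of X1 to
   the point A2 of X2 (giving A) and B2 of X2 to B3 of X3 (giving B).  The local
   ring of X at A is { (f1, f2) | f1 and f2 regular at A1, A2 with the same value }. *)
Record chain := Chain {
  X1 : curve; X2 : curve; X3 : curve;
  A1 : closed_point X1; A2 : closed_point X2;
  B2 : closed_point X2; B3 : closed_point X3;
  A_neq_B : A2 <> B2
}.

(* Cartier divisor on X: its restrictions O(div1), O(div2), O(div3) to the
   components, and a local generator at each of the nodes A and B. *)
Record invsheaf (X : chain) := InvSheaf {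
  div1 : divisor (X1 X); div2 : divisor (X2 X); div3 : divisor (X3 X);
  genA1 : fun_field (X1 X); genA2 : fun_field (X2 X);
  genB2 : fun_field (X2 X); genB3 : fun_field (X3 X);
  genA1P : is_generator (A1 X) div1 genA1;
  genA2P : is_generator (A2 X) div2 genA2;
  genB2P : is_generator (B2 X) div2 genB2;
  genB3P : is_generator (B3 X) div3 genB3
}.

Definition multidegree (X : chain) (L : invsheaf X) : int * int * int :=
  (deg (div1 L), deg (div2 L), deg (div3 L)).

Definition sect (X : chain) : lmodType k :=
  (fun_field (X1 X) * fun_field (X2 X) * fun_field (X3 X))%type.

Definition res1 (X : chain) (s : sect X) : fun_field (X1 X) := s.1.1.
Definition res2 (X : chain) (s : sect X) : fun_field (X2 X) := s.1.2.
Definition res3 (X : chain) (s : sect X) : fun_field (X3 X) := s.2.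

Definition glues (C C' : curve) (P : closed_point C) (P' : closed_point C')
    (f : fun_field C) (f' : fun_field C') : Prop :=
  exists c : k, has_value P f c /\ has_value P' f' c.

(* H^0(X, L) *)
Definition H0 (X : chain) (L : invsheaf X) : set (sect X) :=
  [set s | [/\ H0_curve (div1 L) (res1 s), H0_curve (div2 L) (res2 s),
               H0_curve (div3 L) (res3 s),
               glues (A1 X) (A2 X) (res1 s / genA1 L) (res2 s / genA2 L) &
               glues (B2 X) (B3 X) (res2 s / genB2 L) (res3 s / genB3 L)]].

(* Local parameters of the branches at the nodes.  They choose, within its
   isomorphism class, the gluing at the nodes of each sheaf L_il below, in such
   a way that L_d and L_d~ twisted down at the nodes have the same restriction
   to X_q^c (resp. X_q), as subsheaves of the sheaf of rational functions. *)
Record node_params (X : chain) := NodeParams {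
  tA1 : fun_field (X1 X); tA2 : fun_field (X2 X);
  tB2 : fun_field (X2 X); tB3 : fun_field (X3 X);
  tA1P : ord_at (A1 X) tA1 = 1; tA2P : ord_at (A2 X) tA2 = 1;
  tB2P : ord_at (B2 X) tB2 = 1; tB3P : ord_at (B3 X) tB3 = 1
}.

Section Twist.
Variables (X : chain) (t : node_params X) (L : invsheaf X) (m n : nat).

Let D1 := div1 L - << A1 X >> *+ m.
Let D2 := div2 L + << A2 X >> *+ m - << B2 X >> *+ n.
Let D3 := div3 L + << B3 X >> *+ n.

Fact twist_genA1 : is_generator (A1 X) D1 (genA1 L * tA1 t ^+ m).
Proof. exact: generatorM (genA1P L) (generatorX _ (tA1P t)). Qed.

Fact twist_genA2 : is_generator (A2 X) D2 (genA2 L * tA2 t ^- m).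
Proof.
have [_ h] := generator_away n (@A_neq_B X).
have := generatorM (generatorM (genA2P L) (generatorXN m (tA2P t))) h.
by rewrite mulr1.
Qed.

Fact twist_genB2 : is_generator (B2 X) D2 (genB2 L * tB2 t ^+ n).
Proof.
have [h _] := generator_away m (not_eq_sym (@A_neq_B X)).
have := generatorM (generatorM (genB2P L) h) (generatorX n (tB2P t)).
by rewrite mulr1.
Qed.

Fact twist_genB3 : is_generator (B3 X) D3 (genB3 L * tB3 t ^- n).
Proof. exact: generatorM (genB3P L) (generatorXN _ (tB3P t)). Qed.

Definition twist : invsheaf X :=
  InvSheaf twist_genA1 twist_genA2 twist_genB2 twist_genB3.

End Twist.

Inductive component := C1 | C2 | C3.

Definition eq_component (p q : component) : bool :=
  match p, q with C1, C1 | C2, C2 | C3, C3 => true | _, _ => false end.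

Fact eq_componentP : Equality.axiom eq_component.
Proof. by case; case; constructor. Qed.

HB.instance Definition _ := hasDecEq.Build component eq_componentP.

Definition components := [:: C1; C2; C3].

(* Subcurves are sets Y of components: pred1 q is X_q and predC1 q is X_q^c. *)
Definition vanishes_on (X : chain) (s : sect X) (q : component) : Prop :=
  match q with C1 => res1 s = 0 | C2 => res2 s = 0 | C3 => res3 s = 0 end.

(* V^{Y,0} *)
Definition vanishing (X : chain) (V : set (sect X)) (Y : {pred component}) :
    set (sect X) :=
  [set s | V s /\ forall q, q \in Y -> vanishes_on s q].

(* restriction to Y followed by extension by zero *)
Definition restrict_extend (X : chain) (Y : {pred component}) (s : sect X) :
    sect X :=
  (if C1 \in Y then res1 s else 0, if C2 \in Y then res2 s else 0,
   if C3 \in Y then res3 s else 0).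

Definition mdeg := (nat * nat * nat)%type.

(* e is the multidegree d~ associated to d and q *)
Definition is_tilde (q : component) (d e : mdeg) : bool :=
  let: (i, m, l) := d in let: (i', m', l') := e in
  match q with
  | C1 => [&& i == i'.+1, m' == m.+1 & l' == l]
  | C2 => [&& i' == i.+1, m == m'.+2 & l' == l.+1]
  | C3 => [&& i' == i, m' == m.+1 & l == l'.+1]
  end.

(* phi_{d,e}, for e = d~ or d = e~; the map is 0 for any other pair (d, e) *)
Definition phi (X : chain) (d e : mdeg) (s : sect X) : sect X :=
  if [seq q <- components | is_tilde q d e] is q :: _
  then restrict_extend (predC1 q) s
  else if [seq q <- components | is_tilde q e d] is q :: _
  then restrict_extend (pred1 q) s
  else 0.

Fixpoint phi_from (X : chain) (d : mdeg) (ds : seq mdeg) (s : sect X) : sect X :=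
  if ds is e :: ds' then phi_from e ds' (phi d e s) else s.

(* the composition of the maps phi along a sequence of multidegrees *)
Definition phi_along (X : chain) (ds : seq mdeg) (s : sect X) : sect X :=
  if ds is d :: ds' then phi_from d ds' s else s.

Definition path12 (d : nat) : seq mdeg :=
  [seq (d - j, j, 0)%N | j <- iota 0 d.+1].
Definition path23 (d : nat) : seq mdeg :=
  [seq (0, d - j, j)%N | j <- iota 0 d.+1].

Section LimitSeries.
Variables (X : chain) (t : node_params X) (d r : nat) (L : invsheaf X).

(* L_{il}, of multidegree (i, d - i - l, l) *)
Definition L_il (i l : nat) : invsheaf X := twist t L (d - i) l.

Definition LX1 := L_il d 0.
Definition LX2 := L_il 0 0.
Definition LX3 := L_il 0 d.

Record refined_data := RefinedData {
  V1 : set (sect X); V2 : set (sect X); V3 : set (sect X);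
  V1_sub : V1 `<=` H0 LX1; V2_sub : V2 `<=` H0 LX2; V3_sub : V3 `<=` H0 LX3;
  V1_dim : has_dim V1 r.+1; V2_dim : has_dim V2 r.+1; V3_dim : has_dim V3 r.+1;
  linked12 : phi_along (path12 d) @` V1 `<=` V2;
  linked21 : phi_along (rev (path12 d)) @` V2 `<=` V1;
  linked23 : phi_along (path23 d) @` V2 `<=` V3;
  linked32 : phi_along (rev (path23 d)) @` V3 `<=` V2;
  res1_inj : forall s s', V1 s -> V1 s' -> res1 s = res1 s' -> s = s';
  res2_inj : forall s s', V2 s -> V2 s' -> res2 s = res2 s' -> s = s';
  res3_inj : forall s s', V3 s -> V3 s' -> res3 s = res3 s' -> s = s';
  ordA1 : 'I_r.+1 -> nat; ordA2 : 'I_r.+1 -> nat;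
  ordB2 : 'I_r.+1 -> nat; ordB3 : 'I_r.+1 -> nat;
  ordA1_incr : {homo ordA1 : x y / (x < y)%N};
  ordA2_incr : {homo ordA2 : x y / (x < y)%N};
  ordB2_incr : {homo ordB2 : x y / (x < y)%N};
  ordB3_incr : {homo ordB3 : x y / (x < y)%N};
  ordA1P : vanishing_orders (div1 LX1) (@res1 X @` V1) (A1 X) = range ordA1;
  ordA2P : vanishing_orders (div2 LX2) (@res2 X @` V2) (A2 X) = range ordA2;
  ordB2P : vanishing_orders (div2 LX2) (@res2 X @` V2) (B2 X) = range ordB2;
  ordB3P : vanishing_orders (div3 LX3) (@res3 X @` V3) (B3 X) = range ordB3;
  refinedA : forall j, (ordA1 (rev_ord j) + ordA2 j = d)%N;
  refinedB : forall j, (ordB2 j + ordB3 (rev_ord j) = d)%N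
}.

(* K_{il} *)
Definition K_il (h : refined_data) (i l : nat) : set (sect X) :=
  [set s | [/\ H0 (L_il i l) s,
     series_sub (div1 LX1) (@res1 X @` V1 h) (<< A1 X >> *+ (d - i)) (res1 s),
     series_sub (div2 LX2) (@res2 X @` V2 h)
       (<< A2 X >> *+ i + << B2 X >> *+ l) (res2 s) &
     series_sub (div3 LX3) (@res3 X @` V3 h) (<< B3 X >> *+ (d - l)) (res3 s)]].

End LimitSeries.

(* the number beta attached to V = V_{d''} *)
Definition beta (X : chain) (V : set (sect X)) : nat :=
  (dim (vanishing V (pred1 C1))
   - dim (sum_space (vanishing V (predC1 C2)) (vanishing V (predC1 C3))))%N.

(* u_1, ..., u_n in V^{X_1,0} is a basis of a complement of
   V^{X_2^c,0} (+) V^{X_3^c,0} in V^{X_1,0} *)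
Definition complement_basis (X : chain) (V : set (sect X)) n
    (u : 'I_n -> sect X) : Prop :=
  [/\ forall j, vanishing V (pred1 C1) (u j), lin_indep u &
      is_direct_sum (vanishing V (pred1 C1))
        (sum_space (vanishing V (predC1 C2)) (vanishing V (predC1 C3)))
        (lin_span u)].

End Curves.

(* Main.v *)
Require Import Defs.
From HB Require Import structures.
From mathcomp Require Import all_boot all_order all_algebra.
From mathcomp Require Import boolp classical_sets.
From mathcomp Require Import freeg.
From mathcomp Require Import zify ring.

Set Implicit Arguments.
Unset Strict Implicit.
Unset Printing Implicit Defensive.

Import Order.TTheory GRing.Theory Num.Theory.

Local Open Scope classical_set_scope.
Local Open Scope ring_scope.

(** Write p_q for restriction to the component X_q followed by extension by zero,
    and p_q^c for the complementary projection; all the maps phi are such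
    projections of the product of the three function fields.

    The core is linear algebra.  The space V'' is exactly linked to V' and V''':
    its sections supported on X_3 are the restrictions of V' to X_3, those
    supported on X_2 are the restrictions of V''' to X_2, and the u_j complete
    these two to the sections vanishing on X_1.  The generators of V are chosen so
    that V restricts, away from X_1, exactly onto these three pieces; the
    directness of the decomposition determines the sections of V vanishing on each
    component.  Then p_1^c maps V onto the kernel of p_1 in V'', and p_1 maps V''
    onto the kernel of p_1^c in V, so that V and V'' have the same dimension by
    rank-nullity (exact_extension).

    If i + l = d there is no V''', and if l = 0 there is no V'.  The argument goes
    through with a projection of V'' in its place, provided that V'' has no nonzero
    section supported on X_2, respectively on X_3.  A section supported on one
    component vanishes at its nodes.  On X_3 it would have vanishing order at least
    d + 1 at B in V_(X_3), which contradicts the bound c_r <= d given by refinedness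
    (K_i0_supported3).  On X_2 it would be a section of a
    sheaf of degree -1 (K_il_supported2).

    The latter is impossible because a rational function f has no more zeros than
    poles (deg_H0_curve).  Both numbers are compared with the degree of the
    function field K over k(f).  Local bases at the zeros of f, glued by weak
    approximation, are independent over k(f) (zeros_poly_free).  Conversely, if
    y_1, ..., y_N are independent over k(f) and have no poles but those of f, a
    combination of the f^a y_i with a < m has no poles, and vanishes at those of f,
    as soon as N exceeds the number of poles of f and m is large, because its polar
    parts have fewer coordinates than it has coefficients (poly_free_poles).  This
    contradicts the
    fact that a nonconstant function has a pole (transcendental_pole): its inverse
    z lies in the maximal ideal of a maximal subring of K in which z is not
    invertible, which is a valuation ring by Zorn's lemma and elimination, and a
    discrete one because chains of divisors of z are independent over k(z), over
    which K is finite (poly_free_bound, divisor_chain_bound). *)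

(** * Linear dependence by counting *)

Section Counting.
Variables (k : fieldType) (M : lmodType k).

Lemma underdetermined_system (I J : finType) (A : I -> J -> k) :
  (#|J| < #|I|)%N ->
  exists2 c : I -> k, (exists i, c i != 0) &
    forall j, \sum_i c i * A i j = 0.
Proof.
move=> ltJI; pose B := \matrix_(i < #|I|, j < #|J|) A (enum_val i) (enum_val j).
have : kermx B != 0.
  rewrite kermx_eq0 /row_free neq_ltn.
  by rewrite (leq_ltn_trans (rank_leq_col B) ltJI).
case/rowV0Pn => v /sub_kermxP vB v0.
exists (fun i => v 0 (enum_rank i)).
  have /rV0Pn[i vi] := v0; exists (enum_val i); by rewrite enum_valK.
move=> j; have /rowP/(_ (enum_rank j)) := vB; rewrite !mxE => {2}<-.
rewrite (reindex (@enum_val I I)) /=; last exact: onW_bij (enum_val_bij _).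
by apply: eq_bigr => i _; rewrite mxE !enum_rankK enum_valK.
Qed.

Lemma dependent_of_span (I J : finType) (w : I -> M) (e : J -> M) :
  (#|J| < #|I|)%N ->
  (forall i, exists a : J -> k, w i = \sum_j a j *: e j) ->
  exists2 c : I -> k, (exists i, c i != 0) & \sum_i c i *: w i = 0.
Proof.
move=> ltJI /choice[A wA].
have [c c0 cA] := underdetermined_system A ltJI; exists c => //.
under eq_bigr => i _ do rewrite wA scaler_sumr.
rewrite exchange_big /= big1 // => j _.
under eq_bigr => i _ do rewrite scalerA.
by rewrite -scaler_suml cA scale0r.
Qed.

End Counting.

(** * Linear independence over k(z) *)

Section PolyFree.
Variables (k : closedFieldType) (K : fieldAlgType k).
Implicit Types (z x y : K) (p q : {poly k}).

(** Freeness over k[z] is the same as over k(z), by clearing denominators, and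
    involves no fractions. *)
Definition poly_free z (I : finType) (u : I -> K) : Prop :=
  forall p : I -> {poly k}, \sum_i horner_alg z (p i) * u i = 0 ->
  forall i, p i = 0.

(** The coefficients of a nontrivial relation can be divided by the largest power
    of X that is common to them, so that it suffices to look at relations that
    are nontrivial modulo z. *)
Lemma poly_free_mod z (I : finType) (u : I -> K) : z != 0 ->
  (forall p : I -> {poly k}, \sum_i horner_alg z (p i) * u i = 0 ->
     forall i, (p i).[0] = 0) ->
  poly_free z u.
Proof.
move=> z0 hu p; have [n] := ubnP (\sum_i size (p i)).
elim: n p => // n IH p; rewrite ltnS => le_n sum0 i0.
have /(_ _)/eqP/rootP hr := hu _ sum0.
have /choice[p' hp'] : forall i, exists q, p i = q * 'X.
  move=> i; have /factor_theorem[q ->] : root (p i) 0 by apply/rootP; exact: hu.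
  by exists q; rewrite subr0.
have [->//|pi0] := eqVneq (p i0) 0.
suff p'0 : forall i, p' i = 0 by rewrite hp' p'0 mul0r.
apply: IH.
  apply: leq_trans le_n; rewrite (bigD1 i0) //= [X in (_ < X)%N](bigD1 i0) //=.
  rewrite -addSn leq_add //.
    rewrite hp' size_mulX //; apply: contra_neq pi0 => h; by rewrite hp' h mul0r.
  apply: leq_sum => i _; rewrite hp'.
  have [->|pi] := eqVneq (p' i) 0; first by rewrite mul0r.
  by rewrite size_mulX.
apply: (mulIf z0); rewrite mul0r -[RHS]sum0 mulr_suml; apply: eq_bigr => i _.
by rewrite hp' rmorphM /= horner_algX mulrAC.
Qed.

End PolyFree.

Lemma horner_alg_sum (k : closedFieldType) (K : fieldAlgType k) (x : K)
    (p : {poly k}) n : (size p <= n)%N ->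
  horner_alg x p = \sum_(i < n) p`_i *: x ^+ i.
Proof.
move=> sp; have {1}-> : p = \poly_(i < n) p`_i.
  apply/polyP => i; rewrite coef_poly; case: ltnP => // ni.
  by rewrite nth_default // (leq_trans sp).
rewrite poly_def raddf_sum; apply: eq_bigr => i _.
by rewrite /= linearZ /= rmorphXn /= horner_algX mulr_algl.
Qed.

Section Finiteness.
Variables (k : closedFieldType) (K : fieldAlgType k).
Hypothesis FK : is_function_field K.

(** Multiplication by z raises degrees in x by at most some delta, after
    clearing denominators.  Hence the products z^a u_i with a < m span a space
    whose dimension grows like m delta [K : k(x)], which bounds the number of
    the u_i when they are independent over k[z]. *)
Lemma poly_free_bound (z : K) :
  exists B : nat, forall (I : finType) (u : I -> K), poly_free z u ->
  (#|I| <= B)%N.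
Proof.
case: FK => x [xtr [n [e He]]].
pose T D y := exists2 p : 'I_n -> {poly k}, forall j, (size (p j) <= D)%N &
  y = \sum_j horner_alg x (p j) * e j.
have T_le D D' y : (D <= D')%N -> T D y -> T D' y.
  by move=> DD [p hp ->]; exists p => // j; exact: leq_trans DD.
have TM D D' y (p : {poly k}) : (size p <= D')%N -> T D y -> T (D + D')%N (horner_alg x p * y).
  move=> sp [q hq ->]; exists (fun j => p * q j).
    by move=> j; have := size_polyMleq p (q j); have := hq j; lia.
  by rewrite mulr_sumr; apply: eq_bigr => j _; rewrite rmorphM mulrA.
have Tsum (J : finType) D (y : J -> K) : (forall j, T D (y j)) -> T D (\sum_j y j).
  move=> hy; have /choice[p hp] : forall j, exists p : 'I_n -> {poly k},
      (forall i, (size (p i) <= D)%N) /\ y j = \sum_i horner_alg x (p i) * e i.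
    by move=> j; have [p] := hy j; exists p.
  exists (fun i => \sum_j p j i).
    move=> i; apply: (leq_trans (size_sum _ _ _)); apply/bigmax_leqP => j _.
    by case: (hp j).
  under eq_bigr => j _ do rewrite (hp j).2.
  rewrite exchange_big; apply: eq_bigr => i _.
  by rewrite raddf_sum mulr_suml.
have Tden (J : finType) (y : J -> K) : exists2 q : {poly k}, q != 0 &
    exists D, forall j, T D (horner_alg x q * y j).
  have /choice[q hq] : forall j, exists q : {poly k}, q != 0 /\
      exists D, T D (horner_alg x q * y j).
    move=> j; have [q [p [q0 qy]]] := He (y j); exists q; split=> //.
    exists (\max_j size (p j))%N; exists p => // i.
    exact: (@leq_bigmax _ (fun i => size (p i))).
  exists (\prod_j q j); first by apply/prodf_neq0 => j _; case: (hq j).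
  have /choice[D hD] : forall j, exists D, T D (horner_alg x (\prod_i q i) * y j).
    move=> j; have [_ [D hD]] := hq j.
    exists (D + size (\prod_(i | i != j) q i)%R)%N.
    have -> : \prod_i q i = (\prod_(i | i != j) q i) * q j.
      by rewrite (bigD1 j) //= mulrC.
    by rewrite rmorphM /= -mulrA; apply: TM.
  exists (\max_j D j)%N => j; apply: (T_le (D j)) => //.
  exact: (@leq_bigmax _ D).
have [q q0 [D1 hq]] := Tden _ (fun j => z * e j).
pose Q := horner_alg x q; pose D := (D1 + size q)%N.
have Q0 : Q != 0 by exact: xtr.
have TQ N y : T N y -> T (N + D)%N (Q * y).
  by move=> hy; apply: (T_le (N + size q)%N); rewrite ?leq_add2l ?leq_addl //; apply: TM.
have TQz N y : T N y -> T (N + D)%N (Q * z * y).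
  case=> p hp ->; rewrite mulr_sumr; apply: Tsum => j.
  have -> : Q * z * (horner_alg x (p j) * e j) = horner_alg x (p j) * (Q * (z * e j)) by ring.
  apply: (T_le (D1 + N)%N); last by apply: TM => //; exact: hq.
  by rewrite /D addnC leq_add2l leq_addr.
exists (n * D)%N => I u uf; rewrite leqNgt; apply/negP => lt_I.
have [q' q'0 [E hq']] := Tden _ u; pose Q' := horner_alg x q'.
have Q'0 : Q' != 0 by exact: xtr.
pose m := (n * E).+1.
pose w (ia : I * 'I_m) := Q' * Q ^+ m * (z ^+ ia.2 * u ia.1).
have Tw ia : T (E + m * D)%N (w ia).
  case: ia => i a; rewrite /w /=.
  have Tpow b c : T (E + (b + c) * D)%N ((Q * z) ^+ b * (Q ^+ c * (Q' * u i))).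
    elim: b => [|b IH].
      rewrite expr0 mul1r add0n; elim: c => [|c IH]; first by rewrite expr0 mul1r mul0n addn0.
      by rewrite exprS -mulrA mulSn addnCA addnC; exact: TQ.
    by rewrite exprS -mulrA addSn mulSn addnCA addnC; exact: TQz.
  have lam : (a <= m)%N by exact: ltnW.
  have := Tpow a (m - a)%N; rewrite subnKC // exprMn.
  congr (T _ _); have -> : Q ^+ m = Q ^+ a * Q ^+ (m - a) by rewrite -exprD subnKC.
  ring.
have [||c [ia0 c0] sum0] := @dependent_of_span k K (I * 'I_m)%type
    ('I_n * 'I_(E + m * D))%type w (fun jb => x ^+ jb.2 * e jb.1).
- rewrite !card_prod !card_ord mulnDr (leq_trans (_ : _ < n * D * m + m)%N) //.
    by rewrite mulnCA addnC mulnC -mulnA ltn_add2l /m.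
  by rewrite -mulSnr leq_mul2r lt_I orbT.
- move=> ia; have [p sp ->] := Tw ia.
  exists (fun jb : 'I_n * 'I_(E + m * D) => (p jb.1)`_jb.2).
  rewrite -(pair_bigA _ (fun j (b : 'I_(E + m * D)) => (p j)`_b *: (x ^+ b * e j))) /=.
  apply: eq_bigr => j _; rewrite (horner_alg_sum _ (sp j)) mulr_suml.
  by apply: eq_bigr => b _; rewrite scalerAl.
have {}sum0 : \sum_i \sum_a c (i, a) *: w (i, a) = 0.
  by rewrite pair_bigA -[RHS]sum0; apply: eq_bigr => -[].
case/eqP: c0.
have /uf/(_ ia0.1)/polyP/(_ ia0.2) : \sum_i horner_alg z (\poly_(a < m) c (i, inord a)) * u i = 0.
  apply: (mulfI (mulf_neq0 Q'0 (expf_neq0 m Q0))); rewrite mulr0 -[RHS]sum0 mulr_sumr.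
  apply: eq_bigr => i _; rewrite (horner_alg_sum _ (size_poly _ _)).
  rewrite mulr_suml mulr_sumr; apply: eq_bigr => a _.
  by rewrite coef_poly ltn_ord inord_val /w /= -scalerAl -scalerAr.
by rewrite coef0 coef_poly ltn_ord inord_val; case: ia0.
Qed.

End Finiteness.

(** * Valuations at a closed point *)

Definition transcendental (k : closedFieldType) (K : fieldAlgType k) (z : K) :=
  forall p : {poly k}, horner_alg z p = 0 -> p = 0.

Section Transcendental.
Variables (k : closedFieldType) (K : fieldAlgType k).
Implicit Types z y : K.

Lemma horner_alg_split (z : K) (p : {poly k}) :
  exists s : seq k, horner_alg z p = lead_coef p *: \prod_(c <- s) (z - c%:A).
Proof.
have [s ->] := closed_field_poly_normal p; exists s.
rewrite linearZ /= lead_coefZ (monicP (monic_prod_XsubC _ _ _)) mulr1 mulr_algl.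
by rewrite rmorph_prod; congr (_ *: _); apply: eq_bigr => c _; rewrite rmorphB /=
  horner_algX horner_algC.
Qed.

Lemma algebraic_constant z : ~ transcendental z -> exists c : k, z = c%:A.
Proof.
move=> /existsNP[p /not_implyP[pz /eqP p0]].
have [s] := horner_alg_split z p; rewrite pz => /esym/eqP.
rewrite scaler_eq0 lead_coef_eq0 (negPf p0) /= prodf_seq_eq0 => /hasP[c _ /=].
by rewrite subr_eq0 => /eqP ->; exists c.
Qed.

Lemma transcendental_neq0 z : transcendental z -> z != 0.
Proof.
move=> ztr; apply/eqP => z0; have := ztr 'X; rewrite horner_algX => /(_ z0)/eqP.
by rewrite polyX_eq0.
Qed.

Lemma transcendentalV z : transcendental z -> transcendental z^-1.
Proof.
move=> ztr; apply: contrapT => /algebraic_constant[c /(congr1 GRing.inv)].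
rewrite invrK => zc; have [c0|c0] := eqVneq c 0.
  by have := transcendental_neq0 ztr; rewrite zc c0 scale0r invr0 eqxx.
have {}zc : z = c^-1%:A.
  rewrite zc; apply: (mulfI (_ : c%:A != 0 :> K)); first by rewrite scaler_eq0 oner_eq0 orbF.
  by rewrite mulfV ?scaler_eq0 ?oner_eq0 ?orbF // mulr_algl scalerA divff // scale1r.
have := ztr ('X - (c^-1)%:P); rewrite rmorphB /= horner_algX horner_algC zc subrr.
by move=> /(_ erefl)/eqP; rewrite polyXsubC_eq0.
Qed.

Lemma horner_alg_mod z (p : {poly k}) :
  exists q : {poly k}, horner_alg z p = (p.[0])%:A + z * horner_alg z q.
Proof.
have /factor_theorem[q /eqP] : root (p - (p.[0])%:P) 0.
  by rewrite /root !hornerE subrr.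
rewrite subr0 subr_eq => /eqP pE; exists q.
by rewrite {1}pE rmorphD rmorphM /= horner_algX horner_algC addrC mulrC.
Qed.

End Transcendental.

Section Valuations.
Variables (k : closedFieldType) (C : curve k).
Local Notation K := (fun_field C).
Implicit Types (P : closed_point C) (f g y : K) (n : int).

(** Membership of f in the fractional ideal of order n at P; the guard puts 0 in
    all of these ideals. *)
Definition ord_ge P n f : Prop := f != 0 -> n <= ord_at P f.

Lemma ord_ge0 P n : ord_ge P n 0. Proof. by move/eqP. Qed.

Lemma ord_geC P (c : k) : ord_ge P 0 c%:A.
Proof. by move=> _; rewrite ord_atC. Qed.

Lemma ord_geM P m n f g : ord_ge P m f -> ord_ge P n g -> ord_ge P (m + n) (f * g).
Proof.
move=> hf hg; rewrite /ord_ge mulf_eq0 negb_or => /andP[f0 g0].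
by rewrite ord_atM // lerD ?hf ?hg.
Qed.

Lemma ord_geD P n f g : ord_ge P n f -> ord_ge P n g -> ord_ge P n (f + g).
Proof.
move=> hf hg fg0.
have [f0|f0] := eqVneq f 0; first by move: fg0; rewrite f0 add0r => /hg.
have [g0|g0] := eqVneq g 0; first by move: fg0; rewrite g0 addr0 => /hf.
by apply: le_trans (ord_atD P f0 g0 fg0); rewrite le_min hf // hg.
Qed.

Lemma ord_geZ P n (c : k) f : ord_ge P n f -> ord_ge P n (c *: f).
Proof. by rewrite -mulr_algl -{2}[n]add0r; apply: ord_geM; exact: ord_geC. Qed.

Lemma ord_geN P n f : ord_ge P n f -> ord_ge P n (- f).
Proof. by rewrite -scaleN1r; exact: ord_geZ. Qed.

Lemma ord_geB P n f g : ord_ge P n f -> ord_ge P n g -> ord_ge P n (f - g).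
Proof. by move=> hf /ord_geN; exact: ord_geD. Qed.

Lemma ord_ge_sum P n (I : Type) (r : seq I) (Q : pred I) (F : I -> K) :
  (forall i, Q i -> ord_ge P n (F i)) -> ord_ge P n (\sum_(i <- r | Q i) F i).
Proof.
by move=> hF; elim/big_ind: _ => //; [exact: ord_ge0|move=> *; exact: ord_geD].
Qed.

Lemma ord_ge_le P m n f : m <= n -> ord_ge P n f -> ord_ge P m f.
Proof. by move=> mn hf f0; rewrite (le_trans mn) ?hf. Qed.

Lemma ord_geX P f (n : nat) : ord_ge P 0 f -> ord_ge P 0 (f ^+ n).
Proof.
move=> hf; elim: n => [|n IH]; first by rewrite /ord_ge expr0 ord_at1.
by rewrite exprS -[0]addr0; exact: ord_geM.
Qed.

Lemma ord_ge_horner P f (p : {poly k}) : ord_ge P 0 f -> ord_ge P 0 (horner_alg f p).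
Proof.
move=> hf; rewrite (horner_alg_sum _ (leqnn _)); apply: ord_ge_sum => i _.
by apply: ord_geZ; exact: ord_geX.
Qed.

(** The ultrametric inequality applied to f + g and to f = (f + g) - g. *)
Lemma ord_at_dominant P f g : f != 0 -> ord_ge P (ord_at P f + 1) g ->
  f + g != 0 /\ ord_at P (f + g) = ord_at P f.
Proof.
move=> f0 hg; have fg0 : f + g != 0.
  apply/eqP => /eqP; rewrite addr_eq0 => /eqP fg.
  have /hg : g != 0 by move: f0; rewrite fg oppr_eq0.
  suff -> : ord_at P g = ord_at P f by rewrite gerDl.
  by rewrite fg -scaleN1r -mulr_algl ord_atM ?ord_atC ?add0r // ?scaler_eq0 ?oner_eq0
    ?oppr_eq0 ?oner_eq0 //; move: f0; rewrite fg oppr_eq0.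
split=> //; apply/eqP; rewrite eq_le; apply/andP; split; last first.
  suff : ord_ge P (ord_at P f) (f + g) by apply.
  by apply: ord_geD; [move=> _ | apply: ord_ge_le hg; lia].
rewrite leNgt; apply/negP => lt; have : ord_ge P (ord_at P f + 1) f.
  rewrite -{2}[f](addrK g); apply: ord_geB => // _. by rewrite lezD1.
by move=> /(_ f0); lia.
Qed.

(** The residue field at P is k: if y had no value in k at P, then k(y) would
    embed into the residue field, and all powers of y would be independent over
    k[t], t a uniformizer. *)
Lemma residue P y : ord_ge P 0 y -> exists c : k, ord_ge P 1 (y - c%:A).
Proof.
move=> y_reg; apply: contrapT => /forallNP noval.
have ord0 c : y - c%:A != 0 /\ ord_at P (y - c%:A) = 0.
  have [y0 lt] : y - c%:A != 0 /\ ~ 1 <= ord_at P (y - c%:A).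
    by have /not_implyP := noval c.
  split=> //; have := ord_geB y_reg (@ord_geC P c) y0; move: lt.
  by move: (ord_at P _) => o; lia.
have unit_y (q : {poly k}) : q != 0 -> ~ ord_ge P 1 (horner_alg y q).
  move=> q0; have [s ->] := horner_alg_split y q.
  suff [h0 h1] : lead_coef q *: \prod_(c <- s) (y - c%:A) != 0 /\
      ord_at P (lead_coef q *: \prod_(c <- s) (y - c%:A)) = 0.
    by move=> /(_ h0); rewrite h1.
  rewrite -mulr_algl; have lc0 : (lead_coef q)%:A != 0 :> K.
    by rewrite scaler_eq0 lead_coef_eq0 (negPf q0) oner_eq0.
  suff [h0 h1] : \prod_(c <- s) (y - c%:A) != 0 /\
      ord_at P (\prod_(c <- s) (y - c%:A)) = 0.
    by rewrite mulf_neq0 // ord_atM // ord_atC h1.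
  elim/big_ind: _ => //; first by rewrite oner_eq0 ord_at1.
  by move=> f g [f0 hf] [g0 hg]; rewrite mulf_neq0 // ord_atM // hf hg.
have [t tP] := ord_at_norm P; have t0 := uniformizer_neq0 tP.
have t1 : ord_ge P 1 t by rewrite /ord_ge tP.
have [B hB] := poly_free_bound (fun_fieldP C) t.
suff /hB : poly_free t (fun i : 'I_B.+1 => y ^+ i) by rewrite card_ord ltnn.
apply: poly_free_mod => // p sum0 i; apply/eqP/negPn/negP => pi0.
pose q := \poly_(i < B.+1) (p (inord i)).[0].
apply: (unit_y q).
  apply: contra_neq pi0 => /polyP/(_ i).
  by rewrite coef_poly ltn_ord inord_val coef0.
have -> : horner_alg y q = - (\sum_i (horner_alg t (p i) - (p i).[0]%:A) * y ^+ i).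
  rewrite (horner_alg_sum _ (size_poly _ _)); apply/eqP; rewrite -subr_eq0 opprK.
  rewrite -big_split /= -[eqbRHS]sum0; apply/eqP; apply: eq_bigr => j _.
  by rewrite coef_poly ltn_ord inord_val mulrBl mulr_algl addrC subrK.
apply: ord_geN; apply: ord_ge_sum => j _.
have [r ->] := horner_alg_mod t (p j); rewrite addrC addKr -mulrA.
rewrite -[1]addr0; apply: ord_geM => //; rewrite -[0]addr0; apply: ord_geM.
  by apply: ord_ge_horner; apply: ord_ge_le t1.
exact: ord_geX.
Qed.

(** Polar parts: modulo the maximal ideal at P, the functions with a pole of
    order at most n at P have n + 1 coordinates, the coefficients of their
    Laurent expansions. *)
Lemma laurent P t (n : nat) y : ord_at P t = 1 -> ord_ge P (- n%:Z) y ->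
  exists c : 'I_n.+1 -> k, ord_ge P 1 (y - \sum_i c i *: t ^- i).
Proof.
move=> tP; have t0 := uniformizer_neq0 tP.
elim: n y => [|n IH] y hy.
  have [c hc] := residue hy; exists (fun _ => c).
  by rewrite big_ord1 expr0 invr1.
have [c hc] : exists c : k, ord_ge P 1 (t ^+ n.+1 * y - c%:A).
  apply: residue; rewrite -[0](subrr n.+1%:Z); apply: ord_geM => // _.
  by rewrite ord_atX // tP natz.
have [|c' hc'] := IH (y - c *: t ^- n.+1).
  have -> : y - c *: t ^- n.+1 = t ^- n.+1 * (t ^+ n.+1 * y - c%:A).
    by rewrite mulrBr mulKf ?expf_neq0 // mulr_algr.
  apply: (@ord_ge_le _ _ (- n.+1%:Z + 1)); first by lia.
  by apply: ord_geM => // _; rewrite ord_atV ?expf_neq0 // ord_atX // tP natz.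
exists (fun i => oapp c' c (unlift ord_max i)).
rewrite big_ord_recr /= unlift_none /= opprD addrCA addrC.
suff -> : \sum_(i < n.+1)
    oapp c' c (unlift ord_max (widen_ord (leqnSn n.+1) i)) *: t ^- i
  = \sum_i c' i *: t ^- i by [].
apply: eq_bigr => i _; have -> : widen_ord (leqnSn n.+1) i = fintype.lift ord_max i.
  by apply/val_inj; rewrite /= /bump leqNgt ltn_ord.
by rewrite liftK.
Qed.

End Valuations.

(** * Existence of poles *)

Section ValuationRing.
Variables (k : closedFieldType) (C : curve k).
Local Notation K := (fun_field C).
Variable O : set K.
Hypothesis OC : forall c : k, O c%:A.
Hypothesis OB : forall f g, O f -> O g -> O (f - g).
Hypothesis OM : forall f g, O f -> O g -> O (f * g).
Hypothesis Oval : forall f, O f \/ O f^-1.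
Implicit Types (f g t : K).

Lemma val_ring0 : O 0. Proof. by rewrite -(scale0r 1); exact: OC. Qed.
Lemma val_ring1 : O 1. Proof. by rewrite -(scale1r 1); exact: OC. Qed.
#[local] Hint Resolve val_ring0 val_ring1 : core.
Lemma val_ringN f : O f -> O (- f). Proof. by rewrite -sub0r; exact: OB. Qed.
Lemma val_ringD f g : O f -> O g -> O (f + g).
Proof. by move=> hf /val_ringN hg; rewrite -[g]opprK; exact: OB. Qed.
Lemma val_ringX f n : O f -> O (f ^+ n).
Proof. by move=> hf; elim: n => // n IH; rewrite exprS; exact: OM. Qed.

Lemma val_ring_horner f (p : {poly k}) : O f -> O (horner_alg f p).
Proof.
move=> hf; rewrite (horner_alg_sum _ (leqnn _)); elim/big_ind: _ => //; first exact: val_ringD.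
move=> i _; rewrite -mulr_algl; apply: OM => //; exact: val_ringX.
Qed.

(** The maximal ideal of the valuation ring O. *)
Definition nonunit f : Prop := O f /\ (f = 0 \/ ~ O f^-1).

Lemma nonunit_val_ring f : nonunit f -> O f. Proof. by case. Qed.

Lemma nonunit0 : nonunit 0. Proof. by split; [exact: val_ring0 | left]. Qed.

#[local] Hint Resolve nonunit0 : core.

Lemma nonunitM f g : O f -> nonunit g -> nonunit (f * g).
Proof.
move=> hf [hg hg']; split; first exact: OM.
have [->|f0] := eqVneq f 0; first by left; rewrite mul0r.
case: hg' => [->|hg']; first by left; rewrite mulr0.
right=> h; apply: hg'; have := OM hf h.
by rewrite invfM mulrA mulfV // mul1r.
Qed.

Lemma nonunitD f g : nonunit f -> nonunit g -> nonunit (f + g).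
Proof.
wlog fg : f g / O (f / g) => [hw|].
  by have [h|] := Oval (f / g); [exact: hw | rewrite invf_div addrC => h *; exact: hw].
move=> hf hg; have [g0|g0] := eqVneq g 0; first by rewrite g0 addr0.
have -> : f + g = (f / g + 1) * g by rewrite mulrDl divfK // mul1r.
by apply: nonunitM => //; exact: val_ringD.
Qed.

Lemma nonunit1 : ~ nonunit 1.
Proof. by case=> _ [/eqP|]; rewrite ?oner_eq0 // invr1. Qed.

Lemma nonunitC (c : k) : nonunit c%:A -> c = 0.
Proof.
move=> mc; apply/eqP/negPn/negP => c0; apply: nonunit1.
by have := nonunitM (OC c^-1) mc; rewrite mulr_algl scalerA mulVf // scale1r.
Qed.

Lemma nonunitV f : f != 0 -> ~ O f -> nonunit f^-1.
Proof.
move=> f0 nf; have [//|h] := Oval f; split=> //.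
by right; rewrite invrK.
Qed.

(** A chain w = x_0, x_1, ..., x_B of elements of the maximal ideal, each a
    multiple of the next by a nonunit, consists of elements that are independent
    over k[w]; so its length is bounded.  This is what makes O discrete. *)
Lemma divisor_chain_bound w : w != 0 -> nonunit w -> exists B : nat, forall x : nat -> K,
  x 0%N = w -> (forall i, (i <= B)%N -> x i != 0 /\ nonunit (x i)) ->
  (forall i, (i < B)%N -> nonunit (x i / x i.+1)) -> False.
Proof.
move=> w0 mw; have [B hB] := poly_free_bound (fun_fieldP C) w.
exists B => x x0 xm xd.
suff /hB : poly_free w (fun i : 'I_B.+1 => x i) by rewrite card_ord ltnn.
have mdiv i j : (i < j <= B)%N -> nonunit (x i / x j).
  case/andP; elim: j => // j IH; rewrite ltnS leq_eqVlt => /orP[/eqP ->|lt] lejB.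
    exact: xd.
  have xj0 : x j != 0 by case: (xm j (ltnW lejB)).
  have -> : x i / x j.+1 = x i / x j * (x j / x j.+1).
    by rewrite mulrA divfK.
  by apply: nonunitM; [apply: nonunit_val_ring; apply: IH; rewrite // ltnW | exact: xd].
have Odiv j : (j <= B)%N -> O (w / x j).
  move=> jB; rewrite -x0; case: j jB => [|j] jB.
    by rewrite mulfV // x0.
  exact/nonunit_val_ring/mdiv.
have m_horner (p : {poly k}) : nonunit (horner_alg w p - (p.[0])%:A).
  have [q ->] := horner_alg_mod w p; rewrite addrC addKr mulrC; apply: nonunitM => //.
  exact/val_ring_horner/nonunit_val_ring.
apply: poly_free_mod => // p sum0 i; apply/eqP/negPn/negP => pi0.
have [j pj0 jmax] := @arg_maxnP 'I_B.+1 i (fun i => (p i).[0] != 0) val pi0.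
have [xj0 mxj] := xm j (ltn_ord j).
case/eqP: pj0; apply: nonunitC.
have -> : (p j).[0]%:A = - (horner_alg w (p j) - (p j).[0]%:A)
    - \sum_(l < B.+1 | l != j) horner_alg w (p l) * x l / x j.
  apply: (mulIf xj0); rewrite mulrBl mulNr mulrBl mulr_suml.
  under eq_bigr => l _ do rewrite divfK //.
  move: sum0; rewrite (bigD1 j) //= => /eqP; rewrite addrC addr_eq0 => /eqP ->.
  by rewrite opprB opprK subrK.
have mN f : nonunit f -> nonunit (- f).
  by move=> hf; rewrite -scaleN1r -mulr_algl; apply: nonunitM.
apply: nonunitD; apply: mN => //.
elim/big_ind: _ => //; first exact: nonunitD.
move=> l lj; rewrite -mulrA.
move: (lj); rewrite -val_eqE /= neq_ltn => /orP[lt|gt].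
  apply: nonunitM; last by apply: mdiv; rewrite lt -ltnS ltn_ord.
  exact/val_ring_horner/nonunit_val_ring.
have : (p l).[0] = 0.
  by apply/eqP/negPn/negP => /jmax /=; rewrite leqNgt gt.
have [q ->] := horner_alg_mod w (p l) => ->; rewrite scale0r add0r.
have -> : w * horner_alg w q * (x l / x j) = horner_alg w q * (w / x j) * x l.
  by ring.
apply: nonunitM; last by case: (xm l (ltn_ord l)).
by apply: OM; [exact/val_ring_horner/nonunit_val_ring | exact: (Odiv _ (ltn_ord j))].
Qed.

(** If no element generated the maximal ideal, every element of it could be
    divided by another one with nonunit quotient, and chains could be continued
    forever. *)
Lemma uniformizer_exists w : w != 0 -> nonunit w ->
  exists t, [/\ t != 0, nonunit t & forall f, nonunit f -> O (f / t)].
Proof.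
move=> w0 mw; apply: contrapT => /forallNP no_t.
have /choice[next hnext] : forall t, exists t', t != 0 -> nonunit t ->
    [/\ t' != 0, nonunit t' & nonunit (t / t')].
  move=> t; have [[t0 mt]|h] := pselect (t != 0 /\ nonunit t); last first.
    by exists 0 => t0 mt; case: h.
  have [f mf nO] : exists2 f, nonunit f & ~ O (f / t).
    apply: contrapT => h; apply: (no_t t); split=> // f mf.
    by apply: contrapT => nO; apply: h; exists f.
  have f0 : f != 0 by apply/eqP => f0; apply: nO; rewrite f0 mul0r.
  exists f => _ _; split=> //; rewrite -invf_div; apply: nonunitV => //.
  by rewrite mulf_neq0 ?invr_eq0.
have [B hB] := divisor_chain_bound w0 mw.
have xm i : iter i next w != 0 /\ nonunit (iter i next w).
  by elim: i => //= i [x0 mx]; case: (hnext _ x0 mx).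
apply: (hB (fun i => iter i next w)) => // i _ /=.
by have [x0 mx] := xm i; case: (hnext _ x0 mx).
Qed.

Section Order.
Variable t : K.
Hypothesis t0 : t != 0.
Hypothesis mt : nonunit t.
Hypothesis tgen : forall f, nonunit f -> O (f / t).

Definition val_unit f := O f /\ O f^-1.

Lemma val_unitV f : val_unit f -> val_unit f^-1.
Proof. by case=> h h'; split; rewrite ?invrK. Qed.

Lemma val_unitM f g : val_unit f -> val_unit g -> val_unit (f * g).
Proof. by case=> ? ? [? ?]; split; rewrite ?invfM; exact: OM. Qed.

(** If f were divisible by all powers of t, then f, t^B, t^(B-1), ..., t would be a
    divisor chain of arbitrary length starting from f. *)
Lemma val_order_exists f : f != 0 -> exists n : int, val_unit (f / t ^ n).
Proof.
wlog Of : f / O f => [hw f0|f0].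
  have [|/hw] := Oval f; first by move/hw; exact.
  rewrite invr_eq0 => /(_ f0)[n /val_unitV]; rewrite invfM !invrK => h; exists (- n).
  by rewrite -invr_expz invrK.
have [Ofi|nOfi] := pselect (O f^-1); first by exists 0; rewrite expr0z divr1.
have mf : nonunit f by split=> //; right.
have [B hB] := divisor_chain_bound f0 mf.
have he : exists e, ~~ `[< O (f / t ^+ e) >].
  apply: contrapT => /forallNP h.
  have {}h e : O (f / t ^+ e) by have /negP := h e; rewrite negbK => /asboolP.
  apply: (hB (fun i => if i is 0%N then f else t ^+ (B.+1 - i))) => //.
    case=> [|i] iB //; rewrite expf_neq0 //; split=> //.
    by rewrite subSS -(subnSK iB) exprSr; apply: nonunitM => //; exact/val_ringX/nonunit_val_ring.
  case=> [|i] iB.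
    have -> : f / t ^+ (B.+1 - 1) = f / t ^+ B.+1 * t.
      by rewrite subn1 [in RHS]exprSr invfM -!mulrA mulVf ?mulr1.
    exact: nonunitM.
  by rewrite !subSS -(subnSK (ltnW iB)) exprS mulfK // expf_neq0.
case: (ex_minnP he) => -[|n].
  by move=> /asboolP[]; rewrite expr0 divr1.
move=> /asboolPn hn nmin; exists n%:Z.
have Of' : O (f / t ^+ n).
  by apply: contrapT => /asboolPn/nmin; rewrite ltnn.
split=> //; apply: contrapT => nO; apply: hn.
have := tgen (conj Of' (or_intror nO)).
by rewrite exprSr invfM mulrA.
Qed.

Lemma val_ring_uniformizerV n : (0 < n)%N -> ~ O (t ^- n).
Proof.
case: n => // n _ h; have : O (t ^+ n * t ^- n.+1) by apply: OM => //; exact/val_ringX/nonunit_val_ring.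
rewrite exprS invfM mulrCA mulfV ?expf_neq0 // mulr1.
by case: mt => _ [/eqP|]; rewrite ?(negPf t0).
Qed.

Definition val_order f : int := if f == 0 then 0 else xget 0 [set n | val_unit (f / t ^ n)].

Lemma val_order_unit f : f != 0 -> val_unit (f / t ^ val_order f).
Proof.
by move=> f0; rewrite /val_order (negPf f0); exact: xgetPex (val_order_exists f0).
Qed.

Lemma val_order_geP f n : f != 0 -> n <= val_order f <-> O (f / t ^ n).
Proof.
move=> f0; have [h h'] := val_order_unit f0.
have fE : f / t ^ n = f / t ^ val_order f * t ^ (val_order f - n).
  by rewrite expfzDr // mulrA divfK ?expfz_neq0 // -invr_expz.
split=> [|hO].
  rewrite -subr_ge0 fE; case: (val_order f - n) => // a _; apply: OM => //; exact/val_ringX/nonunit_val_ring.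
rewrite leNgt; apply/negP => lt.
have : O (t ^ (val_order f - n)).
  by have := OM h' hO; rewrite fE mulKf // mulf_neq0 // invr_eq0 expfz_neq0.
have [a -> a0] : exists2 a : nat, val_order f - n = - a%:Z & (0 < a)%N.
  by exists `|n - val_order f|%N; move: lt; lia.
by rewrite -invr_expz; apply: val_ring_uniformizerV.
Qed.

Lemma val_order_eq f n : f != 0 -> val_unit (f / t ^ n) -> val_order f = n.
Proof.
move=> f0 [h h']; apply/eqP; rewrite eq_le; apply/andP; split; last exact/val_order_geP.
have [u u'] := val_order_unit f0.
rewrite leNgt; apply/negP => lt.
have hO : O (t ^- `|val_order f - n|).
  have := OM u h'; have -> : f / t ^ val_order f * (f / t ^ n)^-1 = t ^ (n - val_order f).
    by rewrite invf_div mulrC mulrA divfK // expfzDr // -invr_expz.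
  have -> : n - val_order f = - `|val_order f - n|%N%:Z by lia.
  by rewrite -invr_expz.
by apply: (val_ring_uniformizerV _ hO); lia.
Qed.

Lemma val_order0 : val_order 0 = 0. Proof. by rewrite /val_order eqxx. Qed.

Lemma val_orderM f g : f != 0 -> g != 0 -> val_order (f * g) = val_order f + val_order g.
Proof.
move=> f0 g0; apply: val_order_eq; first exact: mulf_neq0.
rewrite expfzDr // invfM mulrACA; apply: val_unitM; exact: val_order_unit.
Qed.

Lemma val_orderD f g : f != 0 -> g != 0 -> f + g != 0 ->
  Num.min (val_order f) (val_order g) <= val_order (f + g).
Proof.
move=> f0 g0 fg0; apply/val_order_geP => //; rewrite mulrDl.
by apply: val_ringD; apply/val_order_geP => //; rewrite ge_min lexx ?orbT.
Qed.

Lemma val_orderC (c : k) : val_order c%:A = 0.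
Proof.
have [->|c0] := eqVneq c 0; first by rewrite scale0r val_order0.
apply: val_order_eq; first by rewrite scaler_eq0 oner_eq0 orbF.
rewrite expr0z divr1; split; first exact: OC.
have -> : (c%:A)^-1 = c^-1%:A :> K; last exact: OC.
apply: (mulfI (_ : c%:A != 0 :> K)); first by rewrite scaler_eq0 oner_eq0 orbF.
by rewrite mulfV ?scaler_eq0 ?oner_eq0 ?orbF // mulr_algl scalerA divff // scale1r.
Qed.

Lemma val_order_norm : exists t, val_order t = 1.
Proof. by exists t; apply: val_order_eq => //; rewrite expr1z divff //; split; rewrite ?invr1. Qed.

Lemma val_order_point : exists P : closed_point C,
  forall f, nonunit f -> f != 0 -> 0 < ord_at P f.
Proof.
exists (ClosedPoint val_order0 val_orderM val_orderD val_orderC val_order_norm) => f mf f0 /=.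
apply: (@lt_le_trans _ _ 1) => //; apply/val_order_geP => //.
by rewrite expr1z; exact: tgen.
Qed.

End Order.

Lemma valuation_ring_point w : w != 0 -> O w -> ~ O w^-1 ->
  exists P : closed_point C, 0 < ord_at P w.
Proof.
move=> w0 Ow nOw; have mw : nonunit w by split=> //; right.
have [t [t0 mt tgen]] := uniformizer_exists w0 mw.
have [P hP] := val_order_point t0 mt tgen.
by exists P; apply: hP.
Qed.

End ValuationRing.

Section Places.
Variables (k : closedFieldType) (C : curve k).
Local Notation K := (fun_field C).
Implicit Types (f g z : K) (A : set K).

(** A maximal subalgebra of this kind is a valuation ring centered at a zero of
    z. *)
Definition noninverting z A : Prop :=
  [/\ forall p : {poly k}, A (horner_alg z p),
      forall f g, A f -> A g -> A (f - g),
      forall f g, A f -> A g -> A (f * g) &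
      ~ A z^-1].

Lemma noninverting_poly z : transcendental z -> noninverting z (range (horner_alg z)).
Proof.
move=> ztr; split.
- by move=> p; exists p.
- by move=> _ _ [p _ <-] [q _ <-]; exists (p - q) => //; rewrite rmorphB.
- by move=> _ _ [p _ <-] [q _ <-]; exists (p * q) => //; rewrite rmorphM.
case=> p _ pz; have z0 := transcendental_neq0 ztr.
have /ztr : horner_alg z ('X * p - 1) = 0.
  by rewrite rmorphB rmorphM rmorph1 /= horner_algX pz mulfV // subrr.
move=> /(congr1 (fun q : {poly k} => q.[0])).
rewrite hornerD hornerN hornerC hornerM hornerX mul0r add0r horner0 => /eqP.
by rewrite oppr_eq0 oner_eq0.
Qed.

Lemma maximal_noninverting z : transcendental z -> exists2 A, noninverting z A &
  forall B, A `<=` B -> noninverting z B -> B `<=` A.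
Proof.
move=> ztr; pose Q A := A = set0 \/ noninverting z A.
have [|A [QA Amax]] := @Zorn_bigcup _ Q.
  move=> F FQ Ftot; have [[X0 [FX0 X00]]|no] := pselect (exists X, F X /\ X !=set0).
    have FP X f : F X -> X f -> noninverting z X.
      by move=> FX Xf; case: (FQ _ FX) => // X_0; move: Xf; rewrite X_0.
    have both f g : (\bigcup_(X in F) X) f -> (\bigcup_(X in F) X) g ->
        exists X, [/\ F X, X f & X g].
      case=> X FX Xf [Y FY Yg]; have [XY|YX] := Ftot _ _ FX FY.
        by exists Y; split=> //; exact: XY.
      by exists X; split=> //; exact: YX.
    right; split.
    - move=> p; exists X0 => //; case: X00 => f X0f.
      by case: (FP _ _ FX0 X0f).
    - move=> f g Ff Fg; have [X [FX Xf Xg]] := both f g Ff Fg.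
      by exists X => //; case: (FP _ _ FX Xf) => _ h _ _; exact: h.
    - move=> f g Ff Fg; have [X [FX Xf Xg]] := both f g Ff Fg.
      by exists X => //; case: (FP _ _ FX Xf) => _ _ h _; exact: h.
    - by case=> X FX Xz; case: (FP _ _ FX Xz).
  left; apply/seteqP; split=> // f [X FX Xf]; case: no; exists X; split=> //.
  by exists f.
have max B : A `<=` B -> noninverting z B -> B `<=` A.
  move=> AB zB; apply: contrapT => nBA; apply: (Amax B); last by right.
  by split.
case: QA => [A0|zA]; last by exists A.
have := max _ _ (noninverting_poly ztr); rewrite A0 => /(_ (@sub0set _ _)).
by move=> /(_ 1); case; exists 1 => //; rewrite rmorph1.
Qed.

(** If neither f nor 1/f were in A, adjoining either would invert z: 1 would be a
    polynomial in f, and one in 1/f, with coefficients in z A.  Of two such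
    relations of the same degree, each can be used to rewrite the leading term of
    the other; the degrees descend until 1 = 0. *)
Lemma maximal_noninverting_valuation z A : noninverting z A ->
  (forall B, A `<=` B -> noninverting z B -> B `<=` A) ->
  forall f, A f \/ A f^-1.
Proof.
move=> [Az AB AM nA] Amax.
have A0 : A 0 by rewrite -(rmorph0 (horner_alg z)); exact: Az.
have A1 : A 1 by rewrite -(rmorph1 (horner_alg z)); exact: Az.
have Azz : A z by rewrite -(horner_algX z); exact: Az.
have AD f g : A f -> A g -> A (f + g).
  by move=> hf hg; rewrite -[g]opprK -[- g]sub0r; apply: (AB) => //; exact: AB.
have z0 : z != 0 by apply/eqP => z0; apply: nA; rewrite z0 invr0.
pose J g := exists2 a, A a & g = z * a.
have JA g : J g -> A g by case=> a Aa ->; exact: AM.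
have JD f g : J f -> J g -> J (f + g).
  by case=> a Aa -> [b Ab ->]; exists (a + b); rewrite ?mulrDr //; exact: AD.
have JM a g : A a -> J g -> J (a * g).
  by move=> Aa [b Ab ->]; exists (a * b); [exact: AM | rewrite mulrCA].
have J0 : J 0 by exists 0; rewrite ?mulr0.
pose R f n := exists2 a : nat -> K, forall i, J (a i) &
  1 = \sum_(i < n) a i * f ^+ i.
have R_adjoin f : ~ A f -> exists n, `[< R f n >].
  move=> nAf; pose B := [set g | exists2 p : {poly K}, forall i, A p`_i & g = p.[f]].
  have sAB : A `<=` B.
    move=> a Aa; exists a%:P; last by rewrite hornerC.
    by move=> i; rewrite coefC; case: eqP.
  have Bf : B f.
    by exists 'X; [move=> i; rewrite coefX; case: eqP | rewrite hornerX].
  have [p Ap pE] : B z^-1.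
    apply: contrapT => nB; apply: nAf; apply: (Amax B) => //; split=> //.
    - by move=> p; exact/sAB.
    - move=> _ _ [p hp ->] [q hq ->]; exists (p - q); last by rewrite !hornerE.
      by move=> i; rewrite coefB; exact: AB.
    - move=> _ _ [p hp ->] [q hq ->]; exists (p * q); last by rewrite !hornerE.
      by move=> i; rewrite coefM; elim/big_ind: _ => // j _; exact: AM.
  exists (size p); apply/asboolP; exists (fun i => z * p`_i).
    by move=> i; exists p`_i.
  rewrite -(mulfV z0) pE horner_coef mulr_sumr.
  by apply: eq_bigr => i _; rewrite mulrA.
have R_le f m n : (m <= n)%N -> R f m -> R f n.
  move=> mn [a Ja aE]; exists (fun i => if (i < m)%N then a i else 0).
    by move=> i; case: ifP.
  rewrite {}aE (big_ord_widen n (fun i => a i * f ^+ i) mn) big_mkcond /=.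
  by apply: eq_bigr => i _; case: ifP => // _; rewrite mul0r.
have R_reduce f N : f != 0 -> R f N.+1 -> R f^-1 N.+1 -> R f N.
  move=> f0 [a Ja aE] [b Jb bE].
  case: N aE bE => [|N] aE bE.
    have [a0 Aa0 a0E] := Ja 0%N; case: nA.
    suff -> : z^-1 = a0 by [].
    by apply: (mulfI z0); rewrite mulfV // aE big_ord1 expr0 mulr1.
  pose c i := (i == 0%N)%:R * b 0%N + (1 - b 0%N) * a i + a N.+1 * b (N.+1 - i)%N.
  exists c.
    move=> i; apply: (JD); last by apply: (JM) => //; exact: JA.
    apply: (JD); last by apply: (JM) => //; apply: (AB) => //; exact: JA.
    by apply: (JM) => //; case: eqP.
  have bE1 : 1 - b 0%N = \sum_(i < N.+1) b i.+1 * f^-1 ^+ i.+1.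
    by rewrite [X in X - _]bE big_ord_recl expr0 mulr1 addrC addKr.
  have bE' : f ^+ N.+1 * (1 - b 0%N) = \sum_(i < N.+1) b (N.+1 - i)%N * f ^+ i.
    rewrite bE1 mulr_sumr [RHS](reindex_inj rev_ord_inj); apply: eq_bigr => i _ /=.
    rewrite (subKn (ltn_ord i)) mulrCA exprVn; congr (_ * _).
    by rewrite -{1}(subnK (ltn_ord i)) exprD mulfK // expf_neq0.
  have aE' : \sum_(i < N.+1) a i * f ^+ i = 1 - a N.+1 * f ^+ N.+1.
    by rewrite [X in X - _]aE [X in _ = X - _]big_ord_recr /= addrK.
  transitivity (b 0%N + (1 - b 0%N) * \sum_(i < N.+1) a i * f ^+ i
      + a N.+1 * \sum_(i < N.+1) b (N.+1 - i)%N * f ^+ i).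
    by rewrite aE' -bE'; ring.
  have b0E : \sum_(i < N.+1) (i == 0 :> nat)%:R * b 0%N * f ^+ i = b 0%N.
    by rewrite big_ord_recl big1 ?addr0 ?mul1r ?mulr1 // => i _; rewrite !mul0r.
  rewrite -[X in X + _ + _]b0E !mulr_sumr -!big_split /=.
  by apply: eq_bigr => i _; rewrite /c; ring.
move=> f; apply: contrapT => /not_orP[nAf nAi].
have f0 : f != 0 by apply/eqP => f0; apply: nAf; rewrite f0.
have noR n : forall g, ~ A g -> ~ A g^-1 -> g != 0 -> ~ (R g n /\ R g^-1 n).
  elim: n => [|n IH] g nAg nAgi g0 [Rg Rgi].
    by case: Rg => a _; rewrite big_ord0 => /eqP; rewrite oner_eq0.
  apply: (IH g) => //; split; first exact: R_reduce.
  by apply: R_reduce; rewrite ?invr_eq0 ?invrK.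
have [n1 /asboolP R1] := R_adjoin _ nAf; have [n2 /asboolP R2] := R_adjoin _ nAi.
apply: (noR (maxn n1 n2) f) => //; split.
  by apply: R_le R1; rewrite leq_maxl.
by apply: R_le R2; rewrite leq_maxr.
Qed.

Lemma transcendental_zero z : transcendental z ->
  exists P : closed_point C, 0 < ord_at P z.
Proof.
move=> ztr; have [A zA Amax] := maximal_noninverting ztr.
have [Az AB AM nA] := zA.
apply: (@valuation_ring_point _ _ A) => //.
- by move=> c; rewrite -(horner_algC z); exact: Az.
- exact: maximal_noninverting_valuation zA Amax.
- exact: transcendental_neq0.
- by rewrite -(horner_algX z); exact: Az.
Qed.

(** Applied in the contrapositive form: a function without poles is constant. *)
Lemma transcendental_pole z : transcendental z ->
  exists P : closed_point C, ord_at P z < 0.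
Proof.
move=> ztr; have [P] := transcendental_zero (transcendentalV ztr).
by rewrite ord_atV ?transcendental_neq0 // oppr_gt0; exists P.
Qed.

End Places.

(** * Independence of valuations *)

Section Approximation.
Variables (k : closedFieldType) (C : curve k).
Local Notation K := (fun_field C).
Implicit Types (P Q R : closed_point C) (f g y z : K) (s : seq (closed_point C)).

Lemma closed_point_eq P Q : (forall f, ord_at P f = ord_at Q f) -> P = Q.
Proof.
case: P Q => [o o0 oM oD oC on] [o' o0' oM' oD' oC' on'] /= /funext oo.
by subst o'; congr ClosedPoint; exact: Prop_irrelevance.
Qed.

Lemma ord_atXz P f (n : int) : f != 0 -> ord_at P (f ^ n) = n * ord_at P f.
Proof.
move=> f0; case: n => n; first by rewrite -exprnP ord_atX // -mulr_natl natz.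
by rewrite NegzE -exprnN ord_atV ?expf_neq0 // ord_atX // -mulr_natl natz mulNr.
Qed.

Lemma ord_at_div P f g : f != 0 -> g != 0 ->
  ord_at P (f / g) = ord_at P f - ord_at P g.
Proof. by move=> f0 g0; rewrite ord_atM ?invr_eq0 // ord_atV. Qed.

Lemma bounded_below (T : eqType) (o : T -> int) (s : seq T) :
  exists m : nat, forall x, x \in s -> 0 < m%:Z + o x.
Proof.
elim: s => [|x s [m hm]]; first by exists 0%N.
exists (m + `|o x|.+1)%N => y; rewrite inE => /orP[/eqP ->|/hm]; lia.
Qed.

Lemma sum_pos_neg (T : Type) (o : T -> int) (s : seq T) :
  \sum_(x <- s) o x = (\sum_(x <- s | (0 < o x)%R) `|o x|)%N%:Z
    - (\sum_(x <- s | (o x < 0)%R) `|o x|)%N%:Z.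
Proof.
elim: s => [|x s IH]; rewrite ?big_nil // !big_cons IH.
case: ltgtP => ox; lia.
Qed.

(** Discrete valuation rings are maximal subrings, so neither of two distinct
    ones contains the other. *)
Lemma separating_pole P Q : P <> Q ->
  exists2 u, u != 0 & ord_at P u < 0 /\ 0 <= ord_at Q u.
Proof.
move=> PQ; apply: contrapT => no.
have reg u : u != 0 -> 0 <= ord_at Q u -> 0 <= ord_at P u.
  by move=> u0 hu; rewrite leNgt; apply/negP => lt; apply: no; exists u.
have unit u : u != 0 -> ord_at Q u = 0 -> ord_at P u = 0.
  move=> u0 hu; apply/eqP; rewrite eq_le reg ?hu // andbT -oppr_ge0 -ord_atV //.
  by rewrite reg ?invr_eq0 // ord_atV // hu oppr0.
have [t tQ] := ord_at_norm Q; have t0 := uniformizer_neq0 tQ.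
have prop u : u != 0 -> ord_at P u = ord_at Q u * ord_at P t.
  move=> u0; have u't : u / t ^ (ord_at Q u) != 0.
    by rewrite mulf_neq0 // invr_eq0 expfz_neq0.
  have := unit _ u't; rewrite !ord_atM ?invr_eq0 ?expfz_neq0 //.
  rewrite !ord_atV ?expfz_neq0 // !ord_atXz // tQ mulr1 subrr => /(_ erefl)/eqP.
  by rewrite subr_eq0 => /eqP.
have [v vP] := ord_at_norm P; have v0 := uniformizer_neq0 vP.
have Pt0 : 0 <= ord_at P t by rewrite reg // tQ.
have Pt : ord_at P t = 1.
  move: Pt0; have := prop _ v0; rewrite vP; case: (ord_at P t) => // n.
  case: (ord_at Q v) => [m|m]; last by nia.
  by move=> /eqP; rewrite -PoszM eq_sym eqz_nat muln_eq1 => /andP[_ /eqP ->].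
apply: PQ; apply: closed_point_eq => u.
have [->|u0] := eqVneq u 0; first by rewrite !ord_at0.
by rewrite prop // Pt mulr1.
Qed.

(** Induction on s.  Given z for s and y that separates P from one more point Q, a
    high power of z, multiplied by y, is as needed if Q is neither a zero nor a
    pole of z; if Q is a pole of z, then z^m / (1 + z^m) replaces z^m, being a unit
    at P and Q, and small at the zeros of z. *)
Lemma separating_function P s : P \notin s ->
  exists2 z, z != 0 & ord_at P z < 0 /\ forall Q, Q \in s -> 0 < ord_at Q z.
Proof.
elim: s => [_|Q s IH].
  have [t tP] := ord_at_norm P; have t0 := uniformizer_neq0 tP.
  by exists t^-1; rewrite ?invr_eq0 // ord_atV // tP.
rewrite inE negb_or => /andP[/eqP PQ /IH[z z0 [zP zs]]].
have [u u0 [uP uQ]] := separating_pole PQ.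
have [v v0 [vQ vP]] := separating_pole (not_eq_sym PQ).
pose y := u / v; have y0 : y != 0 by rewrite mulf_neq0 ?invr_eq0.
have yP : ord_at P y < 0.
  by rewrite ord_at_div //; lia.
have yQ : 0 < ord_at Q y.
  by rewrite ord_at_div //; lia.
have [m hm] := bounded_below (fun R => ord_at R y) s.
have zX R n : ord_at R (z ^+ n) = n%:Z * ord_at R z by rewrite exprnP ord_atXz.
have hms R : R \in s -> 0 < ord_at R (z ^+ m.+1) + ord_at R y.
  by move=> Rs; rewrite zX; have := hm _ Rs; have := zs _ Rs; nia.
have zm0 : z ^+ m.+1 != 0 by rewrite expf_neq0.
have [zQ|zQ|zQ] := ltgtP (ord_at Q z) 0.
- have dom R : ord_at R z < 0 -> 1 + z ^+ m.+1 != 0 /\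
      ord_at R (1 + z ^+ m.+1) = ord_at R (z ^+ m.+1).
    move=> zR; rewrite addrC; apply: ord_at_dominant => // _.
    by rewrite ord_at1 zX; nia.
  have [w0 domP] := dom _ zP; have [_ domQ] := dom _ zQ.
  have zw0 : z ^+ m.+1 / (1 + z ^+ m.+1) != 0 by rewrite mulf_neq0 // invr_eq0.
  exists (z ^+ m.+1 / (1 + z ^+ m.+1) * y); first exact: mulf_neq0.
  split=> [|R].
    by rewrite ord_atM // ord_at_div // domP subrr add0r.
  rewrite inE ord_atM // ord_at_div // => /orP[/eqP ->|Rs].
    by rewrite domQ subrr add0r.
  have [|_ ->] := @ord_at_dominant _ _ R 1 (z ^+ m.+1) (oner_neq0 _).
    by move=> _; rewrite ord_at1 zX lezD1 mulr_gt0 // zs.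
  by rewrite ord_at1 subr0; exact: hms.
- by exists z => //; split=> // R; rewrite inE => /orP[/eqP -> |/zs].
exists (z ^+ m.+1 * y); first by rewrite mulf_neq0.
split=> [|R]; first by rewrite ord_atM // zX; nia.
by rewrite inE ord_atM // => /orP[/eqP -> |/hms //]; rewrite zX zQ mulr0 add0r.
Qed.

(** If z has a pole at P and zeros at s, then z / (z + 1) is a unit at P and still
    vanishes on s. *)
Lemma approximate_idempotent P s (n : nat) : P \notin s ->
  exists2 w, w != 0 & ord_at P w = 0 /\ forall Q, Q \in s -> n%:Z <= ord_at Q w.
Proof.
move=> /separating_function[z z0 [zP zs]].
have [w0 wP] : z + 1 != 0 /\ ord_at P (z + 1) = ord_at P z.
  by apply: ord_at_dominant => // _; rewrite ord_at1 lezD1.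
exists ((z / (z + 1)) ^+ n); first by rewrite expf_neq0 // mulf_neq0 ?invr_eq0.
have zw0 : z / (z + 1) != 0 by rewrite mulf_neq0 ?invr_eq0.
split=> [|Q Qs]; rewrite ord_atX // ord_at_div //.
  by rewrite wP subrr mul0rn.
have zQ := zs _ Qs.
have [|_] := @ord_at_dominant _ _ Q 1 z (oner_neq0 _).
  by move=> _; rewrite ord_at1 add0r.
rewrite addrC => ->; rewrite ord_at1 subr0 -mulr_natl natz; nia.
Qed.

Lemma uniformizer_expansion P t (e : nat) (c : 'I_e -> k) : ord_at P t = 1 ->
  ord_ge P e%:Z (\sum_i c i *: t ^+ i) -> forall i, c i = 0.
Proof.
move=> tP hs i; apply/eqP/negPn/negP => ci0.
have t0 := uniformizer_neq0 tP.
have [j cj0 jmin] := @arg_minnP _ i (fun i => c i != 0) val ci0.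
have cE a (n : nat) : a != 0 -> a *: t ^+ n != 0 /\ ord_at P (a *: t ^+ n) = n%:Z.
  move=> a0; rewrite -mulr_algl.
  have aA : a%:A != 0 :> K by rewrite scaler_eq0 oner_eq0 orbF.
  by rewrite mulf_neq0 ?expf_neq0 // ord_atM ?expf_neq0 // ord_atC ord_atX // tP natz.
have [cjt0 cjt] := cE _ j cj0.
have [|] := ord_at_dominant (g := \sum_(i | i != j) c i *: t ^+ i) cjt0 (P := P).
  apply: ord_ge_sum => l lj.
  have [->|cl0] := eqVneq (c l) 0; first by rewrite scale0r; exact: ord_ge0.
  move=> _; have [_ ->] := cE _ l cl0; rewrite cjt.
  by have := jmin _ cl0; move: lj; rewrite -val_eqE /=; lia.
move: hs; rewrite (bigD1 j) //= => hs /hs.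
by move=> le1 ordE; move: le1; rewrite ordE cjt lez_nat leqNgt ltn_ord.
Qed.

End Approximation.

(** * Zeros and poles *)

Section ZerosPoles.
Variables (k : closedFieldType) (C : curve k).
Local Notation K := (fun_field C).
Implicit Types (P Q R : closed_point C) (f g y z : K) (s : seq (closed_point C)).

(** Bases of the local rings at the zeros of f modulo f, lifted to K by
    approximation, show that [K : k(f)] is at least the number of zeros of f. *)
Lemma zeros_poly_free f s : f != 0 -> uniq s ->
  (forall P, P \in s -> 0 < ord_at P f) ->
  exists (I : finType) (y : I -> K), poly_free f y /\
    (#|I| = \sum_(P <- s) `|ord_at P f|)%N.
Proof.
move=> f0 us fs; pose pt i := tnth (in_tuple s) i.
have pts i : pt i \in s by exact: mem_tnth.
have pt_inj : injective pt by apply/tuple_uniqP.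
pose e i := `|ord_at (pt i) f|%N.
have eE i : ord_at (pt i) f = e i by have := fs _ (pts i); rewrite /e; lia.
have /choice[t ht] : forall i, exists t, ord_at (pt i) t = 1.
  by move=> i; exact: ord_at_norm.
(* the orders of w_i at the other zeros outweigh the poles of the powers of t_i *)
have /choice[w hw] : forall i, exists w, [/\ w != 0, ord_at (pt i) w = 0 &
    forall j (a : nat), j != i -> (a < e i)%N -> ord_ge (pt j) (e j)%:Z (w * t i ^+ a)].
  move=> i; pose b j := (e j + e i * `|ord_at (pt j) (t i)|)%N.
  have [|w w0 [wi wj]] :=
      @approximate_idempotent _ _ (pt i) (rem (pt i) s) (\sum_j b j)%N.
    by rewrite mem_rem_uniq // inE eqxx.
  exists w; split=> // j a ji ai _.
  have t0 := uniformizer_neq0 (ht i).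
  have : (\sum_j b j)%N%:Z <= ord_at (pt j) w.
    by apply: wj; rewrite mem_rem_uniq // inE pts andbT (inj_eq pt_inj).
  have : (b j <= \sum_j b j)%N by rewrite (bigD1 j) //= leq_addr.
  rewrite ord_atM ?expf_neq0 // exprnP ord_atXz // /b; move: (\sum_j _)%N => n.
  move: (ord_at _ w) (ord_at _ (t i)) => x z; nia.
pose y (u : {i : 'I_(size s) & 'I_(e i)}) := w (tag u) * t (tag u) ^+ tagged u.
exists {i : 'I_(size s) & 'I_(e i)}, y; split; last first.
  rewrite card_tagged sumnE big_map big_enum /= [RHS]big_tnth.
  by apply: eq_bigr => i _; rewrite card_ord.
have y_reg i u : ord_ge (pt i) 0 (y u).
  case: u => j a; rewrite /y /=; have [w0 wj wji] := hw j.
  have [->|ij] := eqVneq i j; last by apply: ord_ge_le (wji i a ij (ltn_ord a)).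
  have t0 := uniformizer_neq0 (ht j).
  by move=> _; rewrite ord_atM ?expf_neq0 // wj ord_atX // ht natz.
apply: poly_free_mod => // p sum0 [i j].
pose c u := (p u).[0].
pose ca l (a : 'I_(e l)) := c (Tagged (fun i => 'I_(e i)) a).
have gi : ord_ge (pt i) (e i)%:Z (\sum_u c u *: y u).
  have -> : \sum_u c u *: y u = - \sum_u (horner_alg f (p u) - (c u)%:A) * y u.
    apply/eqP; rewrite -subr_eq0 opprK -big_split /= -[eqbRHS]sum0; apply/eqP.
    by apply: eq_bigr => u _; rewrite mulrBl mulr_algl addrC subrK.
  apply: ord_geN; apply: ord_ge_sum => u _.
  have [r ->] := horner_alg_mod f (p u); rewrite addrC addKr -mulrA.
  rewrite -[(e i)%:Z]addr0; apply: ord_geM; first by move=> _; rewrite eE.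
  rewrite -[0]addr0; apply: ord_geM => //; apply: ord_ge_horner => _.
  by rewrite eE.
have hi : ord_ge (pt i) (e i)%:Z (w i * \sum_a ca i a *: t i ^+ a).
  pose F l a := ca l a *: (w l * t l ^+ a).
  have sumE : \sum_u c u *: y u = \sum_l \sum_a F l a.
    by rewrite (sig_big_dep _ _ F) /=; apply: eq_bigr => -[].
  have -> : w i * \sum_a ca i a *: t i ^+ a
      = \sum_u c u *: y u - \sum_(l | l != i) \sum_a F l a.
    rewrite sumE (bigD1 i) //= addrK mulr_sumr.
    by apply: eq_bigr => a _; rewrite -scalerAr.
  apply: ord_geB => //; apply: ord_ge_sum => l li; apply: ord_ge_sum => a _.
  by apply: ord_geZ; have [_ _ wl] := hw l; apply: wl; rewrite // eq_sym.
have [w0 wi _] := hw i.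
apply: (uniformizer_expansion (ht i) (c := ca i) _ j).
by move=> S0; have := hi (mulf_neq0 w0 S0); rewrite ord_atM // wi add0r.
Qed.

(** Clearing the leading coefficient of an equation of y over k[f] makes it
    integral, hence regular wherever f is. *)
Lemma regular_multiple f y : transcendental f ->
  exists2 q : {poly k}, q != 0 &
    forall P, ord_ge P 0 f -> ord_ge P 0 (horner_alg f q * y).
Proof.
move=> ftr; have f0 := transcendental_neq0 ftr.
have [B hB] := poly_free_bound (fun_fieldP C) f.
have : ~ poly_free f (fun i : 'I_B.+1 => y ^+ i).
  by move=> /hB; rewrite card_ord ltnn.
move=> /existsNP[p /not_implyP[sum0 /existsNP[i0 /eqP pi0]]].
have [n pn0 nmax] := @arg_maxnP _ i0 (fun i => p i != 0) val pi0.
exists (p n) => // P fP v0; set a := horner_alg f (p n); set v := a * y.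
have a0 : a != 0 by apply: contra_neq pn0; exact: ftr.
have preg i : ord_ge P 0 (horner_alg f (p i)) by exact: ord_ge_horner.
rewrite leNgt; apply/negP => vP; rewrite -/v in v0.
have lead : a * y ^+ n = - \sum_(i | i != n) horner_alg f (p i) * y ^+ i.
  by apply/eqP; rewrite -addr_eq0; move: sum0; rewrite (bigD1 n) //= => ->.
have lower i : i != n -> p i != 0 -> (i < n)%N.
  by move=> ne_in /nmax /= le_in; rewrite ltn_neqAle le_in andbT.
have n0 : (0 < n)%N.
  rewrite lt0n; apply: contra_neq a0 => n0; move: lead.
  rewrite n0 expr0 mulr1 => ->; rewrite big1 ?oppr0 // => i ne_in.
  have [->|/(lower _ ne_in)] := eqVneq (p i) 0; first by rewrite rmorph0 mul0r.
  by rewrite n0.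
have vn : v ^+ n = - \sum_(i | i != n) a ^+ n.-1 * (horner_alg f (p i) * y ^+ i).
  by rewrite -mulr_sumr -mulrN -lead /v exprMn -{1}(prednK n0) exprSr mulrA.
have : ord_ge P ((n%:Z - 1) * ord_at P v) (v ^+ n).
  rewrite vn; apply: ord_geN; apply: ord_ge_sum => i ne_in.
  have [->|pi] := eqVneq (p i) 0; first by rewrite rmorph0 mul0r mulr0; exact: ord_ge0.
  have lt_in := lower i ne_in pi.
  have -> : a ^+ n.-1 * (horner_alg f (p i) * y ^+ i)
      = horner_alg f (p i) * a ^+ (n.-1 - i) * v ^+ i.
    rewrite /v exprMn -{1}[n.-1](@subnK i); first by rewrite exprD; ring.
    by rewrite -ltnS prednK.
  rewrite -[_ * ord_at P v]add0r; apply: ord_geM.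
    rewrite -[0]addr0; apply: ord_geM => //.
    by apply: ord_geX; exact: ord_ge_horner.
  by move=> _; rewrite ord_atX // -mulr_natl natz; nia.
move=> /(_ (expf_neq0 n v0)); rewrite ord_atX // -mulr_natl natz; nia.
Qed.

(** Counting polar parts bounds [K : k(f)] by the number of poles of f.  Arrange
    that the y_i have no poles but those of f.  The products f^a y_i, a < m, form a family
    of m |I| functions whose polar parts have m deg(poles of f) + O(1)
    coordinates; were |I| larger than the number of poles, some combination of
    them would have no poles at all, and zeros at all poles of f. *)
Lemma poly_free_poles f s (I : finType) (y : I -> K) : transcendental f -> uniq s ->
  (forall P, (P \in s) = (ord_at P f < 0)) -> poly_free f y ->
  (#|I| <= \sum_(P <- s) `|ord_at P f|)%N.
Proof.
move=> ftr us fs yfree; have f0 := transcendental_neq0 ftr.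
wlog yreg : y yfree / forall i P, ord_ge P 0 f -> ord_ge P 0 (y i) => [hw|].
  have /choice[q hq] : forall i, exists q : {poly k}, q != 0 /\
      forall P, ord_ge P 0 f -> ord_ge P 0 (horner_alg f q * y i).
    by move=> i; have [q] := regular_multiple (y i) ftr; exists q.
  apply: (hw (fun i => horner_alg f (q i) * y i)); last by move=> i; case: (hq i).
  move=> p sum0 i; have [q0 _] := hq i; apply: (mulIf q0); rewrite mul0r.
  apply: (yfree (fun i => p i * q i)); rewrite -[RHS]sum0.
  by apply: eq_bigr => j _; rewrite rmorphM mulrA.
rewrite big_tnth leqNgt; set n := size s; set pt := tnth _.
pose d i := `|ord_at (pt i) f|%N; apply/negP => ltI.
have pts i : pt i \in s by exact: mem_tnth.
have dE i : ord_at (pt i) f = - (d i)%:Z by have := pts i; rewrite fs /d; lia.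
have [c hc] := bounded_below (fun ij : 'I_n * I => ord_at (pt ij.1) (y ij.2))
  (enum {: 'I_n * I}).
have /choice[t ht] : forall i, exists t, ord_at (pt i) t = 1.
  by move=> i; exact: ord_at_norm.
pose m := (n * c.+1).+1.
pose N i := (m * d i + c)%N.
pose x (ja : I * 'I_m) := f ^+ ja.2 * y ja.1.
have /choice[A hA] : forall iu : 'I_n * (I * 'I_m), exists a : nat -> k,
    ord_ge (pt iu.1) 1 (x iu.2 - \sum_(l < (N iu.1).+1) a l *: t iu.1 ^- l).
  case=> i [j a] /=; have [|b hb] := laurent (n := N i) (y := x (j, a)) (ht i).
    rewrite /x /ord_ge /= mulf_eq0 negb_or => /andP[_ y0].
    rewrite ord_atM ?expf_neq0 // ord_atX // dE.
    have := hc (i, j); rewrite mem_enum => /(_ isT) /=.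
    have := ltn_ord a; rewrite /N -mulr_natl natz.
    move: (ord_at _ _) => o; nia.
  exists (fun l => b (inord l)).
  suff -> : \sum_(l < (N i).+1) b (inord l) *: t i ^- l = \sum_l b l *: t i ^- l by [].
  by apply: eq_bigr => l _; rewrite inord_val.
pose J := {i : 'I_n & 'I_(N i).+1}.
have [|c' [u0 cu0] c'A] := @underdetermined_system k (I * 'I_m)%type J
    (fun u v => A (tag v, u) (tagged v)).
  rewrite card_tagged sumnE big_map big_enum /= card_prod card_ord.
  under eq_bigr => i _ do rewrite card_ord /N -addnS.
  rewrite big_split /= -big_distrr /= sum_nat_const card_ord -/n.
  rewrite (@leq_trans ((\sum_i d i).+1 * m)%N) //; last by rewrite leq_mul2r ltI orbT.
  by rewrite mulSn mulnC addnC ltn_add2r /m.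
pose g := \sum_u c' u *: x u.
have g_zero i : ord_ge (pt i) 1 g.
  have -> : g = \sum_u c' u *: (x u - \sum_(l < (N i).+1) A (i, u) l *: t i ^- l).
    under [RHS]eq_bigr => u _ do rewrite scalerBr scaler_sumr.
    rewrite sumrB exchange_big /= [X in _ - X]big1 ?subr0 // => l _.
    under eq_bigr => u _ do rewrite scalerA.
    rewrite -scaler_suml.
    by have /= -> := c'A (Tagged (fun i => 'I_(N i).+1) l); rewrite scale0r.
  by apply: ord_ge_sum => u _; apply: ord_geZ; exact: (hA (i, u)).
have g0 : g != 0.
  apply: contra_neq cu0 => g0.
  have {}g0 : \sum_j \sum_a c' (j, a) *: x (j, a) = 0.
    by rewrite pair_bigA -[RHS]g0; apply: eq_bigr => -[].
  have /yfree/(_ u0.1)/polyP/(_ u0.2) :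
      \sum_j horner_alg f (\poly_(a < m) c' (j, inord a)) * y j = 0.
    rewrite -[RHS]g0; apply: eq_bigr => j _.
    rewrite (horner_alg_sum _ (size_poly _ _)) mulr_suml; apply: eq_bigr => a _.
    by rewrite coef_poly ltn_ord inord_val /x /= scalerAl.
  by rewrite coef0 coef_poly ltn_ord inord_val -surjective_pairing.
have g_reg P : ord_ge P 0 g.
  have [/(nthP P)[i ltis <-]|nPs] := boolP (P \in s).
    rewrite -[nth _ _ _]/(nth P (in_tuple s) (Ordinal ltis)) -tnth_nth.
    exact: ord_ge_le (g_zero _).
  have fP : ord_ge P 0 f by move=> _; move: nPs; rewrite fs -leNgt.
  apply: ord_ge_sum => u _; apply: ord_geZ; rewrite -[0]addr0.
  by apply: ord_geM; [exact: ord_geX | exact: yreg].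
have [b gb] : exists b : k, g = b%:A.
  apply: algebraic_constant => /transcendental_pole[P].
  by have := g_reg P g0; case: ltgtP.
have [P] := transcendental_pole ftr; rewrite -fs => /(nthP P)[i ltis _].
by have := g_zero (Ordinal ltis) g0; rewrite gb ord_atC.
Qed.

(** [K : k(f)] separates the number of zeros of f from its number of poles; the
    poles lie in the support of D, and so do the zeros that have to be counted. *)
Lemma deg_H0_curve (D : divisor C) f : f != 0 -> H0_curve D f -> 0 <= deg D.
Proof.
move=> f0 /(_ f0) fD.
have degE : deg D = \sum_(P <- dom D) coeff P D.
  by rewrite -{1}[D]freeg_sumE raddf_sum; apply: eq_bigr => P _; rewrite /= degU.
have [ftr|/algebraic_constant[c fc]] := pselect (transcendental f); last first.
  rewrite degE; apply: sumr_ge0 => P _; have := fD P.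
  by rewrite fc ord_atC add0r.
pose Z := [seq P <- dom D | 0 < ord_at P f].
pose F := [seq P <- dom D | ord_at P f < 0].
have uZ : uniq Z by rewrite filter_uniq // uniq_dom.
have uF : uniq F by rewrite filter_uniq // uniq_dom.
have FE P : (P \in F) = (ord_at P f < 0).
  rewrite mem_filter andb_idr // => lt; rewrite mem_dom; apply/eqP => D0.
  by have := fD P; rewrite D0 addr0 leNgt lt.
have [|I [y [yfree cardI]]] := zeros_poly_free f0 uZ.
  by move=> P; rewrite mem_filter => /andP[].
have := poly_free_poles ftr uF FE yfree; rewrite cardI !big_filter => leZF.
have : \sum_(P <- dom D) ord_at P f <= 0 by rewrite sum_pos_neg subr_le0.
suff : 0 <= deg D + \sum_(P <- dom D) ord_at P f by lia.
by rewrite degE -big_split /=; apply: sumr_ge0 => P _; rewrite addrC.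
Qed.

End ZerosPoles.

(** * Subspaces and dimensions *)

Section Subspace.
Variables (k : fieldType) (M : lmodType k).
Implicit Types (U V W : set M).

Definition is_subspace V : Prop :=
  V 0 /\ forall (c : k) x y, V x -> V y -> V (c *: x + y).

Lemma subspaceD V x y : is_subspace V -> V x -> V y -> V (x + y).
Proof. by move=> [_ h] Vx Vy; rewrite -[x]scale1r; exact: h. Qed.

Lemma subspaceZ V c x : is_subspace V -> V x -> V (c *: x).
Proof. by move=> [h0 h] Vx; rewrite -[c *: x]addr0; exact: h. Qed.

Lemma subspaceB V x y : is_subspace V -> V x -> V y -> V (x - y).
Proof. by move=> [_ h] Vx Vy; rewrite addrC -scaleN1r; exact: h. Qed.

Lemma subspace_sum V n (x : 'I_n -> M) : is_subspace V -> (forall j, V (x j)) ->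
  V (\sum_j x j).
Proof.
move=> sV Vx; elim/big_ind: _ => //; first by case: sV.
by move=> y z; exact: subspaceD.
Qed.

Lemma lin_span_subspace n (u : 'I_n -> M) : is_subspace (lin_span u).
Proof.
split; first by exists (fun _ => 0); rewrite big1 // => j _; rewrite scale0r.
move=> c _ _ [a ->] [b ->]; exists (fun j => c * a j + b j).
by rewrite scaler_sumr -big_split; apply: eq_bigr => j _; rewrite scalerDl scalerA.
Qed.

Lemma has_dim_subspace V n : has_dim V n -> is_subspace V.
Proof. by case=> e [_ ->]; exact: lin_span_subspace. Qed.

Lemma sum_space_subspace V W : is_subspace V -> is_subspace W ->
  is_subspace (sum_space V W).
Proof.
move=> [V0 hV] [W0 hW]; split; first by exists 0 => //; exists 0; rewrite ?addr0.
move=> c _ _ [x Vx [y Wy <-]] [x' Vx' [y' Wy' <-]].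
exists (c *: x + x'); first exact: hV.
by exists (c *: y + y'); [exact: hW | rewrite scalerDr addrACA].
Qed.

Lemma image_subspace (M' : lmodType k) (f : {linear M' -> M}) (V : set M') :
  V 0 -> (forall (c : k) x y, V x -> V y -> V (c *: x + y)) -> is_subspace (f @` V).
Proof.
move=> V0 hV; split; first by exists 0; rewrite ?linear0.
by move=> c _ _ [x Vx <-] [y Vy <-]; exists (c *: x + y); rewrite ?linearP //; exact: hV.
Qed.

Lemma sum_space_absorb V W : is_subspace V -> W 0 -> W `<=` V -> sum_space V W = V.
Proof.
move=> sV W0 WV; apply/seteqP; split=> [_ [x Vx [y /WV Vy <-]]|x Vx].
  exact: subspaceD.
by exists x => //; exists 0; rewrite ?addr0.
Qed.

Lemma sum_spaceC V W : sum_space V W = sum_space W V.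
Proof.
by apply/seteqP; split=> _ [x ? [y ? <-]]; exists y => //; exists x; rewrite // addrC.
Qed.

End Subspace.

(** A subspace of largest dimension among those contained in S exhausts S, since
    any further vector of S could be added to it. *)
Lemma subspace_vspace (k : fieldType) n (S : set 'rV[k]_n) : is_subspace S ->
  exists W : {vspace 'rV[k]_n}, forall c, c \in W <-> S c.
Proof.
move=> sS; have [S0 hS] := sS.
pose Q d := `[< exists2 W : {vspace 'rV[k]_n}, \dim W = d & forall c, c \in W -> S c >].
have exQ : exists d, Q d.
  exists 0%N; apply/asboolP; exists 0%VS; first exact: dimv0.
  by move=> c; rewrite memv0 => /eqP ->.
have leQ d : Q d -> (d <= \dim {: 'rV[k]_n})%N.
  by case/asboolP => W <- _; rewrite dimvS ?subvf.
case: (ex_maxnP exQ leQ) => d /asboolP[W dW WS] dmax; exists W => c; split; first exact: WS.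
move=> Sc; apply/negPn/negP => cW.
suff /dmax : Q d.+1 by rewrite ltnn.
apply/asboolP; exists (W + <[c]>)%VS.
  rewrite dimv_disjoint_sum ?dW ?dim_vline.
    by case: eqP cW => [->|_ _]; rewrite ?mem0v ?addn1.
  apply/eqP; rewrite -subv0; apply/subvP => x; rewrite memv_cap => /andP[xW].
  case/vlineP => a xa; rewrite memv0; have [a0|a0] := eqVneq a 0.
    by rewrite xa a0 scale0r.
  by case/negP: cW; rewrite -[c](scalerK a0) -xa memvZ.
move=> _ /memv_addP[x xW [_ /vlineP[a ->] ->]]; rewrite addrC.
by apply: hS => //; exact: WS.
Qed.

(** Rank-nullity across two maps each of which has the kernel of the other, in
    the respective space, as its image. *)
Lemma exact_pair_has_dim (k : fieldType) (M : lmodType k) (f g : {linear M -> M})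
    (V W : set M) n :
  is_subspace V -> has_dim W n ->
  (forall x, V x -> W (f x) /\ g (f x) = 0) ->
  (forall y, W y -> g y = 0 -> exists2 x, V x & f x = y) ->
  (forall y, W y -> V (g y) /\ f (g y) = 0) ->
  (forall x, V x -> f x = 0 -> exists2 y, W y & g y = x) ->
  has_dim V n.
Proof.
move=> sV [e [eI WE]] VW fsurj WV gsurj.
pose E (c : 'rV[k]_n) := \sum_j c 0 j *: e j.
have Elin : linear E.
  move=> a c c'; rewrite /E scaler_sumr -big_split; apply: eq_bigr => j _.
  by rewrite !mxE scalerDl scalerA.
pose EL : {linear 'rV[k]_n -> M} := HB.pack E (GRing.isLinear.Build _ _ _ _ E Elin).
have WEP y : W y <-> exists c, y = E c.
  rewrite WE; split=> [[c ->]|[c ->]]; last by exists (c 0).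
  by exists (\row_j c j); apply: eq_bigr => j _; rewrite mxE.
have Einj c : E c = 0 -> c = 0.
  by move/(eI (c 0)) => c0; apply/rowP => j; rewrite c0 mxE.
have [Z ZP] : exists Z : {vspace 'rV[k]_n}, forall c, c \in Z <-> g (E c) = 0.
  apply: subspace_vspace; split; first by rewrite -[E]/(EL : _ -> _) !linear0.
  move=> a c c' gc gc'; rewrite -[E]/(EL : _ -> _) !linearP.
  by rewrite /= gc gc' scaler0 addr0.
have /choice[l hl] : forall i : 'I_(\dim Z), exists x, V x /\ f x = E (vbasis Z)`_i.
  move=> i; have /ZP gi : (vbasis Z)`_i \in Z by rewrite vbasis_mem ?mem_nth ?size_tuple.
  have [|x Vx fx] := fsurj (E (vbasis Z)`_i) _ gi; last by exists x.
  by apply/WEP; exists (vbasis Z)`_i.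
pose L (c : 'rV[k]_n) := \sum_i coord (vbasis Z) i c *: l i.
have Llin : linear L.
  move=> a c c'; rewrite /L scaler_sumr -big_split; apply: eq_bigr => i _.
  by rewrite linearP scalerDl scalerA.
pose LL : {linear 'rV[k]_n -> M} := HB.pack L (GRing.isLinear.Build _ _ _ _ L Llin).
have VL c : V (L c).
  by apply: subspace_sum => // i; apply: subspaceZ => //; case: (hl i).
have fL c : c \in Z -> f (L c) = E c.
  move=> cZ; rewrite {2}(coord_vbasis cZ) linear_sum -[E]/(EL : _ -> _) linear_sum.
  by apply: eq_bigr => i _; rewrite !linearZ /= (hl i).2.
pose p := projv Z.
have pZ c : p c \in Z by exact: memv_proj.
have pid c : c \in Z -> p c = c by exact: projv_id.
pose T c := L (p c) + g (E (c - p c)).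
have Tlin : linear T.
  move=> a c c'; rewrite /T linearP -[L]/(LL : _ -> _) -[E]/(EL : _ -> _).
  have -> : a *: c + c' - (a *: p c + p c') = a *: (c - p c) + (c' - p c').
    by rewrite scalerBr opprD addrACA.
  by rewrite !linearP /= scalerDr addrACA.
pose TL : {linear 'rV[k]_n -> M} := HB.pack T (GRing.isLinear.Build _ _ _ _ T Tlin).
have Tinj c : T c = 0 -> c = 0.
  move=> Tc; have : f (T c) = 0 by rewrite Tc linear0.
  have Wc : W (E (c - p c)) by apply/WEP; exists (c - p c).
  rewrite linearD fL // (WV _ Wc).2 addr0 => /Einj pc0.
  move: Tc; rewrite /T pc0 subr0 -[L]/(LL : _ -> _) linear0 add0r => /ZP cZ.
  by rewrite -(pid _ cZ).
exists (fun j => T (delta_mx 0 j)).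
have TE (c : 'I_n -> k) : \sum_j c j *: T (delta_mx 0 j) = T (\row_j c j).
  rewrite [in RHS](row_sum_delta (\row_j c j)) -[T]/(TL : _ -> _) linear_sum.
  by apply: eq_bigr => j _; rewrite linearZ mxE.
split=> [c|].
  by rewrite TE => /Tinj/rowP cE j; have := cE j; rewrite !mxE.
apply/seteqP; split=> [x Vx|_ [c ->]]; last first.
  rewrite TE; apply: subspaceD => //; apply: (WV _ _).1; apply/WEP.
  by eexists.
have [Wfx gfx] := VW _ Vx; have [w fxw] := (WEP _).1 Wfx.
have wZ : w \in Z by apply/ZP; rewrite -fxw.
have [||y Wy gy] := gsurj (x - L w).
- exact: subspaceB.
- by rewrite linearB fL // fxw; exact: subrr.
have [c yE] := (WEP _).1 Wy.
exists (fun j => (w + (c - p c)) 0 j); rewrite TE.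
have -> : \row_j (w + (c - p c)) 0 j = w + (c - p c) by apply/rowP => j; rewrite mxE.
have pw : p (w + (c - p c)) = w.
  by rewrite linearD linearB /= (pid _ wZ) (pid _ (pZ c)) subrr addr0.
rewrite /T pw [w + _]addrC addrK -[E]/(EL : _ -> _) linearB linearB /=.
by rewrite ((ZP _).1 (pZ c)) subr0 -yE gy addrC subrK.
Qed.

(** * Extension of exactly linked subspaces *)

Section Extension.
Variables (k : closedFieldType) (X : chain k).
Local Notation K1 := (fun_field (X1 X)).
Local Notation K2 := (fun_field (X2 X)).
Local Notation K3 := (fun_field (X3 X)).
Implicit Types (Y Z : {pred component}) (A B V : set (sect X)) (s : sect X).

Fact restrict_extend_is_linear Y : linear (@restrict_extend k X Y).
Proof.
move=> c [[x1 x2] x3] [[y1 y2] y3]; rewrite /restrict_extend /=.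
have zero (F : fieldAlgType k) : 0 = c *: (0 : F) + 0 by rewrite scaler0 addr0.
by congr (_, _, _); case: ifP => // _; exact: zero.
Qed.

HB.instance Definition _ Y := GRing.isLinear.Build k (sect X) (sect X) *:%R
  (@restrict_extend k X Y) (restrict_extend_is_linear Y).

(** Vanishing on a subcurve means being fixed by the projection to the other
    components. *)
Lemma image_eq_vanishingP Y Z A B : (forall q, (q \in Z) = (q \notin Y)) ->
  restrict_extend Y @` A = vanishing B Z <->
  (forall s, A s -> B (restrict_extend Y s)) /\
  (forall s, B s -> restrict_extend Y s = s ->
     exists2 s', A s' & restrict_extend Y s' = s).
Proof.
move=> ZY.
have vanE s : (forall q, q \in Z -> vanishes_on s q) <-> restrict_extend Y s = s.
  case: s => [[x y] z]; rewrite /restrict_extend /=; split=> [h|[hx hy hz] q].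
    have := (h C1, h C2, h C3); rewrite !ZY /= /res1 /res2 /res3 /= => -[[h1 h2] h3].
    by congr (_, _, _); case: ifPn => // ?; rewrite ?h1 ?h2 ?h3.
  rewrite ZY; case: q => /negPf nY; move: hx hy hz; rewrite nY => hx hy hz.
  - exact: (esym hx).
  - exact: (esym hy).
  - exact: (esym hz).
have pK s : restrict_extend Y (restrict_extend Y s) = restrict_extend Y s.
  by case: s => [[x y] z]; rewrite /restrict_extend /=; do 3 case: (_ \in Y).
split=> [E|[h1 h2]].
  split=> [s As|s Bs sE].
    have : (restrict_extend Y @` A) (restrict_extend Y s) by exists s.
    by rewrite E; case.
  have : (restrict_extend Y @` A) s by rewrite E; split=> //; exact/vanE.
  by case=> s' As' s'E; exists s'.
apply/seteqP; split=> [_ [s As <-]|s [Bs /vanE sE]].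
  by split; [exact: h1 | apply/vanE; exact: pK].
by have [s' As' s'E] := h2 _ Bs sE; exists s'.
Qed.

Lemma component_pred1C (q p : component) : (p \in predC1 q) = (p \notin pred1 q).
Proof. by rewrite !inE. Qed.

Lemma component_predC1C (q p : component) : (p \in pred1 q) = (p \notin predC1 q).
Proof. by rewrite !inE negbK. Qed.

(** Restricted to X_2 and X_3, the elements of V' give the (0, 0, z) in V'', those
    of V''' give the (0, y, 0) in V'', and the v_j give a basis of a complement.
    So V maps onto the space of sections of V'' that vanish on X_1.  Because the
    complement is direct, a section of V that vanishes on X_2 or on X_3 has no
    component along the v_j, which identifies these sections.  In particular the
    sections of V that vanish on X_2 and X_3 are the restrictions to X_1 of V'',
    and rank-nullity gives V the dimension of V''. *)
Lemma exact_extension (V' V'' V''' : set (sect X)) n m (u v : 'I_m -> sect X) :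
  is_subspace V' -> is_subspace V''' -> has_dim V'' n ->
  restrict_extend (pred1 C3) @` V' = vanishing V'' (predC1 C3) ->
  restrict_extend (predC1 C3) @` V'' = vanishing V' (pred1 C3) ->
  restrict_extend (predC1 C2) @` V'' = vanishing V''' (pred1 C2) ->
  restrict_extend (pred1 C2) @` V''' = vanishing V'' (predC1 C2) ->
  complement_basis V'' u -> (forall j, restrict_extend (predC1 C1) (v j) = u j) ->
  let V := sum_space (sum_space (restrict_extend (predC1 C2) @` V')
             (restrict_extend (predC1 C3) @` V''')) (lin_span v) in
  has_dim V n /\
  [/\ restrict_extend (predC1 C2) @` V' = vanishing V (pred1 C2),
      restrict_extend (pred1 C2) @` V = vanishing V' (predC1 C2),
      restrict_extend (pred1 C1) @` V'' = vanishing V (predC1 C1) &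
      restrict_extend (predC1 C1) @` V = vanishing V'' (pred1 C1)] /\
  (restrict_extend (predC1 C3) @` V''' = vanishing V (pred1 C3) /\
   restrict_extend (pred1 C3) @` V = vanishing V''' (predC1 C3)).
Proof.
move=> sV' sV3 dV2 /image_eq_vanishingP-/(_ (@component_pred1C _))[E1 E1'].
move=> /image_eq_vanishingP-/(_ (@component_predC1C _))[E2 E2'].
move=> /image_eq_vanishingP-/(_ (@component_predC1C _))[E3 E3'].
move=> /image_eq_vanishingP-/(_ (@component_pred1C _))[E4 E4'].
move=> [uV2 uI [uE u_disj]] vu V; have sV2 := has_dim_subspace dV2.
have sV : is_subspace V.
  apply: sum_space_subspace; last exact: lin_span_subspace.
  by apply: sum_space_subspace; apply: image_subspace; [case: sV'..|case: sV3|case: sV3].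
(* the exactness relations, in coordinates *)
have F1 (x : K1) (y : K2) (z : K3) : V' (x, y, z) -> V'' (0, 0, z) by move/E1.
have F1' z : V'' (0, 0, z) -> exists x y, V' (x, y, z).
  by move=> /E1'/(_ erefl)[[[x y] z'] h [<-]]; exists x, y.
have F2 (x : K1) (y : K2) (z : K3) : V'' (x, y, z) -> V' (x, y, 0) by move/E2.
have F2' x y : V' (x, y, 0) -> exists z, V'' (x, y, z).
  by move=> /E2'/(_ erefl)[[[x' y'] z] h [<- <-]]; exists z.
have F3 (x : K1) (y : K2) (z : K3) : V'' (x, y, z) -> V''' (x, 0, z) by move/E3.
have F3' x z : V''' (x, 0, z) -> exists y, V'' (x, y, z).
  by move=> /E3'/(_ erefl)[[[x' y] z'] h [<- <-]]; exists y.
have F4 (x : K1) (y : K2) (z : K3) : V''' (x, y, z) -> V'' (0, y, 0) by move/E4.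
have F4' y : V'' (0, y, 0) -> exists x z, V''' (x, y, z).
  by move=> /E4'/(_ erefl)[[[x y'] z] h [<-]]; exists x, z.
pose w (c : 'I_m -> k) := \sum_j c j *: v j.
pose U (c : 'I_m -> k) := \sum_j c j *: u j.
have wU c : restrict_extend (predC1 C1) (w c) = U c.
  by rewrite linear_sum; apply: eq_bigr => j _; rewrite linearZ /= vu.
have V2U c : V'' (U c).
  by apply: subspace_sum => // j; apply: subspaceZ => //; case: (uV2 j).
have indep c y z : V'' (0, y, 0) -> V'' (0, 0, z) -> U c = (0, y, z) -> w c = 0.
  move=> Vy Vz Uc; suff /uI c0 : U c = 0.
    by rewrite /w big1 // => j _; rewrite c0 scale0r.
  have : [set 0] (U c); last by [].
  rewrite -u_disj; split; last by exists c.
  rewrite Uc; exists (0, y, 0); first by split=> //; case.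
  exists (0, 0, z); first by split=> //; case.
  by congr (_, _, _); rewrite ?add0r ?addr0.
have wE c : exists w1 w2 w3, w c = (w1, w2, w3) /\ U c = (0, w2, w3).
  by rewrite -wU; case: (w c) => [[w1 w2] w3]; exists w1, w2, w3.
have dec y z : V'' (0, y, z) -> exists a b c w1 w2 w3,
    [/\ V'' (0, a, 0), V'' (0, 0, b), w c = (w1, w2, w3), y = a + w2 & z = b + w3].
  move=> Vyz; have : vanishing V'' (pred1 C1) (0, y, z) by split=> //; case.
  rewrite uE => -[_ [[[a1 a2] a3] [Va ha]]] [[[b1 b2] b3] [Vb hb] <-] [_ [c ->]].
  have := (ha C1 erefl, ha C3 erefl); have := (hb C1 erefl, hb C2 erefl).
  rewrite /= /res1 /res2 /res3 /= => -[b10 b20] [a10 a30]; subst.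
  have [w1 [w2 [w3 [wc Uc]]]] := wE c; rewrite -/(U c) Uc => -[_ <- <-].
  by exists a2, b3, c, w1, w2, w3; rewrite addr0 add0r.
have VI c (f1 : K1) (f2 : K2) (f3 : K3) (g1 : K1) (g2 : K2) (g3 : K3) w1 w2 w3 :
    V' (f1, f2, f3) -> V''' (g1, g2, g3) -> w c = (w1, w2, w3) ->
    V (f1 + g1 + w1, g2 + w2, f3 + w3).
  move=> Vf Vg wc; exists (f1 + g1, g2, f3); last first.
    by exists (w c); [exists c | rewrite wc].
  exists (f1, 0, f3); first by exists (f1, f2, f3).
  exists (g1, g2, 0); first by exists (g1, g2, g3).
  by congr (_, _, _); rewrite ?add0r ?addr0.
have VE (x : K1) (y : K2) (z : K3) : V (x, y, z) ->
    exists f1 f2 f3 g1 g2 g3 c w1 w2 w3,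
    [/\ V' (f1, f2, f3), V''' (g1, g2, g3), w c = (w1, w2, w3), U c = (0, w2, w3) &
      [/\ x = f1 + g1 + w1, y = g2 + w2 & z = f3 + w3]].
  case=> _ [_ [[[f1 f2] f3] Vf <-] [_ [[[g1 g2] g3] Vg <-] <-]] [_ [c ->]].
  have [w1 [w2 [w3 [wc Uc]]]] := wE c; rewrite -/(w c) wc => -[<- <- <-].
  exists f1, f2, f3, g1, g2, g3, c, w1, w2, w3; split=> //.
  by split; rewrite ?add0r ?addr0.
have w0 : w (fun _ => 0) = (0, 0, 0).
  by rewrite /w big1 // => j _; rewrite scale0r.
have V'0 : V' (0, 0, 0) by case: sV'.
have V30 : V''' (0, 0, 0) by case: sV3.
have V2D x y z x' y' z' : V'' (x, y, z) -> V'' (x', y', z') ->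
    V'' (x + x', y + y', z + z').
  exact: (@subspaceD _ _ _ (x, y, z) (x', y', z')).
have V'D x y z x' y' z' : V' (x, y, z) -> V' (x', y', z') ->
    V' (x + x', y + y', z + z').
  exact: (@subspaceD _ _ _ (x, y, z) (x', y', z')).
have V3D x y z x' y' z' : V''' (x, y, z) -> V''' (x', y', z') ->
    V''' (x + x', y + y', z + z').
  exact: (@subspaceD _ _ _ (x, y, z) (x', y', z')).
have V2N x y z : V'' (x, y, z) -> V'' (- x, - y, - z).
  move=> h; have := subspaceB sV2 sV2.1 h.
  by congr (V'' _); congr (_, _, _); rewrite ?sub0r.
have V_X23 x y z : V (x, y, z) -> V'' (0, y, z).
  move=> /VE[f1 [f2 [f3 [g1 [g2 [g3 [c [w1 [w2 [w3 [Vf Vg wc Uc [_ -> ->]]]]]]]]]]]].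
  have Vw : V'' (0, w2, w3) by rewrite -Uc.
  have := V2D _ _ _ _ _ _ (V2D _ _ _ _ _ _ (F1 _ _ _ Vf) (F4 _ _ _ Vg)) Vw.
  by rewrite !add0r !addr0.
have V_X2 x z : V (x, 0, z) -> exists y, V' (x, y, z).
  move=> /VE[f1 [f2 [f3 [g1 [g2 [g3 [c [w1 [w2 [w3 [Vf Vg wc Uc [-> /eqP yE ->]]]]]]]]]]]].
  have {}yE : w2 = - g2 by apply/eqP; rewrite -addr_eq0 addrC eq_sym.
  have Vw : V'' (0, w2, w3) by rewrite -Uc.
  have Vw3 : V'' (0, 0, w3).
    by have := V2D _ _ _ _ _ _ Vw (F4 _ _ _ Vg); rewrite yE !addr0 addNr.
  have Vg2 : V'' (0, - g2, 0) by have := V2N _ _ _ (F4 _ _ _ Vg); rewrite !oppr0.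
  move: wc; rewrite (indep c (- g2) w3) // -?yE // => -[w1E w2E w3E].
  have g20 : g2 = 0 by apply/eqP; rewrite -oppr_eq0 -yE -w2E.
  have [|h2 /F2 Vh] := F3' g1 g3; first by rewrite -g20.
  exists (f2 + h2); have := V'D _ _ _ _ _ _ Vf Vh.
  by rewrite -w1E -w3E !addr0.
have V_X3 x y : V (x, y, 0) -> exists z, V''' (x, y, z).
  move=> /VE[f1 [f2 [f3 [g1 [g2 [g3 [c [w1 [w2 [w3 [Vf Vg wc Uc [-> -> /eqP zE]]]]]]]]]]]].
  have {}zE : w3 = - f3 by apply/eqP; rewrite -addr_eq0 addrC eq_sym.
  have Vw : V'' (0, w2, w3) by rewrite -Uc.
  have Vw2 : V'' (0, w2, 0).
    by have := V2D _ _ _ _ _ _ Vw (F1 _ _ _ Vf); rewrite zE !addr0 addNr.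
  have Vf3 : V'' (0, 0, - f3) by have := V2N _ _ _ (F1 _ _ _ Vf); rewrite !oppr0.
  move: wc; rewrite (indep c w2 (- f3)) // -?zE // => -[w1E w2E w3E].
  have f30 : f3 = 0 by apply/eqP; rewrite -oppr_eq0 -zE -w3E.
  have [|h3 /F3 Vh] := F2' f1 f2; first by rewrite -f30.
  exists (h3 + g3); have := V3D _ _ _ _ _ _ Vh Vg.
  by rewrite -w1E -w2E add0r !addr0.
have V_V' x y z : V' (x, y, z) -> V (x, 0, z).
  by move=> Vf; have := VI _ _ _ _ _ _ _ _ _ _ Vf V30 w0; rewrite !addr0.
have V_V3 x y z : V''' (x, y, z) -> V (x, y, 0).
  by move=> Vg; have := VI _ _ _ _ _ _ _ _ _ _ V'0 Vg w0; rewrite !addr0 add0r.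
have V_V2 x y z : V'' (x, y, z) -> V (x, 0, 0) by move=> /F2; exact: V_V'.
have V_X1 x : V (x, 0, 0) -> exists y z, V'' (x, y, z).
  by move=> /V_X2[y /F2'[z Vz]]; exists y, z.
have V_lift y z : V'' (0, y, z) -> exists x, V (x, y, z).
  move=> /dec[a [b [c [w1 [w2 [w3 [/F4'[g1 [g3 Vg]] /F1'[f1 [f2 Vf]] wc -> ->]]]]]]].
  by exists (f1 + g1 + w1); exact: VI Vf Vg wc.
have V_V'2 x y z : V (x, y, z) -> V' (0, y, 0) by move=> /V_X23/F2.
have V_V33 x y z : V (x, y, z) -> V''' (0, 0, z) by move=> /V_X23/F3.
split.
  apply: (@exact_pair_has_dim _ _ (@restrict_extend k X (predC1 C1))
    (@restrict_extend k X (pred1 C1)) V V'' n) => //.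
  - by move=> [[x y] z] /V_X23 h; split.
  - move=> [[x y] z] Vxyz [x0]; move: Vxyz; rewrite /res1 /= in x0 *; rewrite x0.
    by move=> /V_lift[x' Vx]; exists (x', y, z).
  - by move=> [[x y] z] /V_V2 h; split.
  - move=> [[x y] z] Vxyz [y0 z0]; move: Vxyz; rewrite /res2 /res3 /= in y0 z0 *.
    by rewrite y0 z0 => /V_X1[y' [z' Vx]]; exists (x, y', z').
split; split; apply/image_eq_vanishingP; try exact: component_pred1C;
  try exact: component_predC1C; split.
- by move=> [[x y] z] /V_V'.
- by move=> [[x y] z] Vxyz [y0]; move: Vxyz; rewrite -y0 => /V_X2[y' h]; exists (x, y', z).
- by move=> [[x y] z] /V_V'2.
- move=> [[x y] z] Vxyz [x0 z0]; move: Vxyz; rewrite -x0 -z0.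
  by move=> /F2'[z' /V_lift[x' h]]; exists (x', y, z').
- by move=> [[x y] z] /V_V2.
- move=> [[x y] z] Vxyz [y0 z0]; move: Vxyz; rewrite -y0 -z0.
  by move=> /V_X1[y' [z' h]]; exists (x, y', z').
- by move=> [[x y] z] /V_X23.
- move=> [[x y] z] Vxyz [x0]; move: Vxyz; rewrite -x0.
  by move=> /V_lift[x' h]; exists (x', y, z).
- by move=> [[x y] z] /V_V3.
- by move=> [[x y] z] Vxyz [z0]; move: Vxyz; rewrite -z0 => /V_X3[z' h]; exists (x, y, z').
- by move=> [[x y] z] /V_V33.
- move=> [[x y] z] Vxyz [x0 y0]; move: Vxyz; rewrite -x0 -y0.
  by move=> /F3'[y' /V_lift[x' h]]; exists (x', y', z).
Qed.

End Extension.

(** * The spaces K_il *)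

Section GluedSections.
Variables (k : closedFieldType) (C : curve k).
Local Notation K := (fun_field C).
Implicit Types (P : closed_point C) (D : divisor C) (f g : K).

Lemma has_valueP P f (c : k) : has_value P f c <-> ord_ge P 1 (f - c%:A).
Proof.
split=> [[/eqP f0 /negP |lt _]|h] //.
by have [|/h] := eqVneq (f - c%:A) 0; [left | right].
Qed.

Lemma has_value0 P f : has_value P f 0 <-> ord_ge P 1 f.
Proof. by rewrite has_valueP scale0r subr0. Qed.

Lemma value_of_zero P (c : k) : has_value P 0 c -> c = 0.
Proof.
move/has_valueP; rewrite sub0r => /ord_geN; rewrite opprK => h.
apply/eqP/negPn/negP => c0; have := h; rewrite /ord_ge ord_atC scaler_eq0 (negPf c0) oner_eq0.
by move=> /(_ isT).
Qed.

Lemma has_value_lin P (a : k) f g c c' : has_value P f c -> has_value P g c' ->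
  has_value P (a *: f + g) (a * c + c').
Proof.
move=> /has_valueP hf /has_valueP hg; apply/has_valueP.
have -> : a *: f + g - (a * c + c')%:A = a *: (f - c%:A) + (g - c'%:A).
  by rewrite scalerDl scalerBr scalerA opprD addrACA.
by apply: ord_geD => //; exact: ord_geZ.
Qed.

Lemma H0_curveP D f : H0_curve D f <-> forall P, ord_ge P (- coeff P D) f.
Proof.
split=> h; first by move=> P f0; have := h f0 P; rewrite -lerBlDr sub0r.
by move=> f0 P; rewrite -lerBlDr sub0r; exact: h.
Qed.

Lemma H0_curve_lin D (c : k) f g : H0_curve D f -> H0_curve D g ->
  H0_curve D (c *: f + g).
Proof.
move=> /H0_curveP hf /H0_curveP hg; apply/H0_curveP => P.
by apply: ord_geD => //; exact: ord_geZ.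
Qed.

Lemma H0_curve0 D : H0_curve D 0.
Proof. by move=> /eqP. Qed.

Lemma H0_curveDU D P f : H0_curve D f -> H0_curve (D + << P >>) f.
Proof.
move=> /H0_curveP h; apply/H0_curveP => Q; apply: ord_ge_le (h Q).
by rewrite coeffD coeffU lerN2 lerDl mul1r; case: eqP.
Qed.

(** O(D) is the subsheaf of O(D + P) of the sections that vanish at P: this and
    vanishing_section are the two inclusions. *)
Lemma vanishes_in_twist D P f g : H0_curve D f -> is_generator P (D + << P >>) g ->
  has_value P (f / g) 0.
Proof.
move=> /H0_curveP/(_ P) hf [g0 gP]; apply/has_value0.
apply: (@ord_ge_le _ _ P _ (- coeff P D + (coeff P D + 1))); first by rewrite addKr.
apply: ord_geM => // _.
by rewrite ord_atV // gP coeffD coeffU eqxx mulr1 opprK.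
Qed.

Lemma vanishing_section D P f g : H0_curve D f -> is_generator P D g ->
  has_value P (f / g) 0 -> H0_curve (D - << P >>) f.
Proof.
move=> /H0_curveP hf [g0 gP] /has_value0 hfg; apply/H0_curveP => Q.
rewrite coeffB coeffU mul1r; case: eqP => [<-|_]; last by rewrite subr0.
have -> : f = f / g * g by rewrite divfK.
by rewrite opprB; apply: ord_geM => // _; rewrite gP.
Qed.

End GluedSections.

Section Kernels.
Variables (k : closedFieldType) (X : chain k) (t : node_params X) (d r : nat).
Variables (L : invsheaf X) (h : refined_data t d r L).
Local Notation K1 := (fun_field (X1 X)).
Local Notation K2 := (fun_field (X2 X)).
Local Notation K3 := (fun_field (X3 X)).

Lemma glues_lin (C C' : curve k) (P : closed_point C) (P' : closed_point C') (a : k)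
    f f' g g' : glues P P' f f' -> glues P P' g g' ->
  glues P P' (a *: f + g) (a *: f' + g').
Proof.
case=> c [hf hf'] [c' [hg hg']]; exists (a * c + c').
by split; exact: has_value_lin.
Qed.

Lemma glues0 (C C' : curve k) (P : closed_point C) (P' : closed_point C') f f' :
  has_value P f 0 -> has_value P' f' 0 -> glues P P' f f'.
Proof. by exists 0. Qed.

Lemma H0_subspace (M : invsheaf X) : is_subspace (H0 M).
Proof.
have v0 (C : curve k) (P : closed_point C) (g : fun_field C) : has_value P (0 / g) 0.
  by rewrite mul0r; apply/has_value0; exact: ord_ge0.
split; first by split; try exact: H0_curve0; apply: glues0; exact: v0.
move=> c [[x1 x2] x3] [[y1 y2] y3] [? ? ? ? ?] [? ? ? ? ?].
split; try exact: H0_curve_lin; rewrite /res1 /res2 /res3 /= !mulrDl -!scalerAl;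
  exact: glues_lin.
Qed.

Lemma div1_LX1 i l : div1 (LX1 t d L) - << A1 X >> *+ (d - i) = div1 (L_il t d L i l).
Proof. by rewrite /= subnn mulr0n subr0. Qed.

Lemma div2_LX2 i l : (i <= d)%N ->
  div2 (LX2 t d L) - (<< A2 X >> *+ i + << B2 X >> *+ l) = div2 (L_il t d L i l).
Proof. by move=> id; rewrite /= subn0 mulr0n subr0 opprD addrA mulrnBr // addrA. Qed.

Lemma div3_LX3 i l : (l <= d)%N ->
  div3 (LX3 t d L) - << B3 X >> *+ (d - l) = div3 (L_il t d L i l).
Proof. by move=> ld; rewrite /= mulrnBr // opprB -addrA [X in _ + X]addrCA subrr addr0. Qed.

Lemma K_ilP i l s : (i <= d)%N -> (l <= d)%N ->
  K_il h i l s <-> [/\ H0 (L_il t d L i l) s, (@res1 _ X @` V1 h) (res1 s),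
    (@res2 _ X @` V2 h) (res2 s) & (@res3 _ X @` V3 h) (res3 s)].
Proof.
move=> id ld; split=> [[Hs [? _] [? _] [? _]] //|[Hs h1 h2 h3]].
have [s1 s2 s3 _ _] := Hs; split=> //; split=> //.
- by rewrite (div1_LX1 i l).
- by rewrite div2_LX2.
- by rewrite (div3_LX3 i).
Qed.

Lemma K_il_subspace i l : (i <= d)%N -> (l <= d)%N -> is_subspace (K_il h i l).
Proof.
move=> id ld; have [H00 HD] := H0_subspace (L_il t d L i l).
have [[V10 V1D] [V20 V2D] [V30 V3D]] := And3 (has_dim_subspace (V1_dim h))
  (has_dim_subspace (V2_dim h)) (has_dim_subspace (V3_dim h)).
split.
  by apply/K_ilP => //; split=> //; exists 0.
move=> c x y /K_ilP-/(_ id ld)[Hx [x1 ? xE1] [x2 ? xE2] [x3 ? xE3]].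
move=> /K_ilP-/(_ id ld)[Hy [y1 ? yE1] [y2 ? yE2] [y3 ? yE3]].
apply/K_ilP => //; split; first exact: HD.
- by exists (c *: x1 + y1); [exact: V1D | rewrite -[RHS]/(c *: res1 x + res1 y) -xE1 -yE1].
- by exists (c *: x2 + y2); [exact: V2D | rewrite -[RHS]/(c *: res2 x + res2 y) -xE2 -yE2].
- by exists (c *: x3 + y3); [exact: V3D | rewrite -[RHS]/(c *: res3 x + res3 y) -xE3 -yE3].
Qed.

(** In the larger twist, sections of X_1 and X_3 vanish at the nodes, so they
    glue with 0 on X_2. *)
Lemma K_il_restrict13 i l s : (i < d)%N -> (l < d)%N -> K_il h i l s ->
  K_il h i.+1 l.+1 (restrict_extend (predC1 C2) s).
Proof.
move=> id ld; case: s => [[x y] z].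
move=> /K_ilP-/(_ (ltnW id) (ltnW ld))[[s1 s2 s3 _ _] h1 h2 h3].
have h20 : (@res2 _ X @` V2 h) 0.
  by exists 0 => //; case: (has_dim_subspace (V2_dim h)).
have D1 : div1 (L_il t d L i.+1 l.+1) = div1 (L_il t d L i l) + << A1 X >>.
  rewrite /= (_ : d - i = (d - i.+1).+1)%N; last by rewrite subnSK.
  by rewrite mulrSr opprD addrA subrK.
have D3 : div3 (L_il t d L i.+1 l.+1) = div3 (L_il t d L i l) + << B3 X >>.
  by rewrite /= mulrSr addrA.
apply/K_ilP => //; split=> //; split.
- by rewrite D1; exact: H0_curveDU.
- exact: H0_curve0.
- by rewrite D3; exact: H0_curveDU.
- apply: glues0; last by rewrite /res2 /= mul0r; apply/has_value0; exact: ord_ge0.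
  by apply: (vanishes_in_twist s1); rewrite -D1; exact: genA1P.
- apply: glues0; first by rewrite /res2 /= mul0r; apply/has_value0; exact: ord_ge0.
  by apply: (vanishes_in_twist s3); rewrite -D3; exact: genB3P.
Qed.

Lemma K_il_restrict12 i l s : (i <= d)%N -> (l < d)%N -> K_il h i l.+1 s ->
  K_il h i l (restrict_extend (predC1 C3) s).
Proof.
move=> id ld; case: s => [[x y] z].
move=> /K_ilP-/(_ id ld)[[s1 s2 s3 sA _] h1 h2 h3].
have h30 : (@res3 _ X @` V3 h) 0.
  by exists 0 => //; case: (has_dim_subspace (V3_dim h)).
have D2 : div2 (L_il t d L i l) = div2 (L_il t d L i l.+1) + << B2 X >>.
  by rewrite /= mulrSr opprD addrA subrK.
apply/K_ilP; rewrite ?(ltnW ld) //; split=> //; split=> //.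
- by rewrite D2; exact: H0_curveDU.
- exact: H0_curve0.
- apply: glues0; last by rewrite /res3 /= mul0r; apply/has_value0; exact: ord_ge0.
  by apply: (vanishes_in_twist s2); rewrite -D2; exact: genB2P.
Qed.

(** A section of K_il supported on X_2 vanishes at both nodes, so that it is a
    section of a sheaf of degree d - i - l - 2 on X_2. *)
Lemma K_il_supported2 i l (y : K2) : deg (div2 L) = 0 -> (i <= d)%N -> (l <= d)%N ->
  (d < i + l + 2)%N -> K_il h i l (0, y, 0) -> y = 0.
Proof.
move=> dL id ld lt /K_ilP-/(_ id ld)[[_ s2 _ [a []]]].
rewrite {1}/res1 /= mul0r => /value_of_zero -> yA [b []] yB.
rewrite {1}/res3 /= mul0r => /value_of_zero b0 _ _ _; rewrite {}b0 in yB.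
apply/eqP/negPn/negP => y0.
have sA := vanishing_section s2 (genA2P _) yA.
have genB : is_generator (B2 X) (div2 (L_il t d L i l) - << A2 X >>) (genB2 (L_il t d L i l)).
  have [g0 gB] := genB2P (L_il t d L i l); split=> //; rewrite gB coeffB coeffU.
  by case: eqP => [/A_neq_B//|_]; rewrite mulr0 subr0.
have := deg_H0_curve y0 (vanishing_section sA genB yB).
rewrite /= !degB degD dL !degMn !degU !pmulrn; lia.
Qed.

(** Gluing with 0 at B forces one more zero there than the d zeros imposed by
    V_(X_3)(-dB), while the largest vanishing order c_r is at most d. *)
Lemma K_i0_supported3 i (z : K3) : (i <= d)%N -> K_il h i 0 (0, 0, z) -> z = 0.
Proof.
move=> id /K_ilP-/(_ id (leq0n d))[[_ _ s3 _ [b [b0 zB]]] _ _ h3].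
move: b0; rewrite {1}/res2 /= mul0r => /value_of_zero b0; rewrite {}b0 in zB.
apply/eqP/negPn/negP => z0.
have /H0_curveP/(_ (B3 X) z0) := vanishing_section s3 (genB3P _) zB.
rewrite /= mulr0n addr0 coeffB coeffU eqxx mulr1 opprB => ordz.
pose n := ord_at (B3 X) z + coeff (B3 X) (div3 (LX3 t d L)).
have nE : n = ord_at (B3 X) z + coeff (B3 X) (div3 L) + d%:Z.
  by rewrite /n /= coeffD coeffMn coeffU eqxx mulr1 natz addrA.
have n_gt : d%:Z < n.
  by rewrite nE; move: ordz; move: (ord_at _ _) (coeff _ _) => o c; lia.
have : vanishing_orders (div3 (LX3 t d L)) (@res3 _ X @` V3 h) (B3 X) `|n|%N.
  by exists z; split=> //; rewrite gez0_abs // ltW // (le_lt_trans _ n_gt).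
rewrite ordB3P => -[j _ jn].
have := refinedB h (rev_ord j); rewrite rev_ordK jn; move: n_gt; clear; lia.
Qed.

End Kernels.

Lemma phi_tilde (k : closedFieldType) (X : chain k) q d e : is_tilde q d e ->
  @phi k X d e = restrict_extend (predC1 q).
Proof.
case: d => [[i m] l]; case: e => [[i' m'] l'] h; apply/funext => s; rewrite /phi.
suff -> : [seq q <- components | is_tilde q (i, m, l) (i', m', l')] = [:: q] by [].
by case: q h => /= /and3P[/eqP-> /eqP-> /eqP->]; do !case: ifP => //=; lia.
Qed.

Lemma phi_tildeV (k : closedFieldType) (X : chain k) q d e : is_tilde q e d ->
  @phi k X d e = restrict_extend (pred1 q).
Proof.
case: d => [[i m] l]; case: e => [[i' m'] l'] h; apply/funext => s; rewrite /phi.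
have -> : [seq q <- components | is_tilde q (i, m, l) (i', m', l')] = [::].
  by case: q h => /= /and3P[/eqP-> /eqP-> /eqP->]; do !case: ifP => //=; lia.
suff -> : [seq q <- components | is_tilde q (i', m', l') (i, m, l)] = [:: q] by [].
by case: q h => /= /and3P[/eqP-> /eqP-> /eqP->]; do !case: ifP => //=; lia.
Qed.

(** * Construction of the subspace of K_il *)

Section Degenerate.
Variables (k : closedFieldType) (X : chain k).
Implicit Types (q : component) (V W : set (sect X)).

(** When i + l = d there is no V''', and when l = 0 there is no V'.  The projection
    of V'' away from X_2, respectively X_3, takes its place: one exactness relation
    is then automatic, and the other one follows if no nonzero section of V'' is
    supported on that component. *)
Lemma restricted_image_exact q V :
  restrict_extend (predC1 q) @` V
    = vanishing (restrict_extend (predC1 q) @` V) (pred1 q).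
Proof.
apply/image_eq_vanishingP; first exact: component_predC1C.
split=> [s Vs|_ [s Vs <-] _]; first by exists s.
by exists s.
Qed.

Lemma restricted_image_exactV q V : is_subspace V ->
  (forall s, V s -> restrict_extend (pred1 q) s = s -> s = 0) ->
  restrict_extend (pred1 q) @` (restrict_extend (predC1 q) @` V)
    = vanishing V (predC1 q).
Proof.
move=> [V0 _] hV; apply/image_eq_vanishingP; first exact: component_pred1C.
split=> [_ [[[x y] z] Vs <-]|s Vs sE]; first by case: q {hV}.
exists 0; last by rewrite linear0 (hV s).
by exists 0 => //; rewrite linear0.
Qed.

End Degenerate.

Local Ltac check_tilde := apply/and3P; split; apply/eqP; lia.

Theorem proposition4p1 (k : closedFieldType) (X : chain k) (t : node_params X)
    (d r : nat) (L : invsheaf X) (hL : multidegree L = (d%:Z, 0, 0))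
    (h : refined_data t d r L) :
  (* 1 *)
  (forall i l : nat, (0 < i)%N -> (0 < l)%N -> (i + l = d)%N ->
    let dd := (i, d - i - l, l)%N in
    let dd' := (i - 1, d - i - l + 2, l - 1)%N in
    let dd'' := (i - 1, d - i - l + 1, l)%N in
    forall V' V'' : set (sect X),
    V' `<=` K_il h (i - 1) (l - 1) -> has_dim V' r.+1 ->
    V'' `<=` K_il h (i - 1) l -> has_dim V'' r.+1 ->
    phi dd' dd'' @` V' = vanishing V'' (predC1 C3) ->
    phi dd'' dd' @` V'' = vanishing V' (pred1 C3) ->
    forall u v : 'I_(beta V'') -> sect X,
    complement_basis V'' u ->
    (forall j, K_il h i l (v j)) -> (forall j, phi dd dd'' (v j) = u j) ->
    let V := sum_space (phi dd' dd @` V') (lin_span v) in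
    [/\ V `<=` K_il h i l, has_dim V r.+1 &
    [/\ phi dd' dd @` V' = vanishing V (pred1 C2),
        phi dd dd' @` V = vanishing V' (predC1 C2),
        phi dd'' dd @` V'' = vanishing V (predC1 C1) &
        phi dd dd'' @` V = vanishing V'' (pred1 C1)]])
  /\
  (* 2 *)
  (forall i l : nat, (0 < i)%N -> (0 < l)%N -> (i + l + 1 <= d)%N ->
    let dd := (i, d - i - l, l)%N in
    let dd' := (i - 1, d - i - l + 2, l - 1)%N in
    let dd'' := (i - 1, d - i - l + 1, l)%N in
    let dd''' := (i, d - i - l - 1, l + 1)%N in
    forall V' V'' V''' : set (sect X),
    V' `<=` K_il h (i - 1) (l - 1) -> has_dim V' r.+1 ->
    V'' `<=` K_il h (i - 1) l -> has_dim V'' r.+1 ->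
    V''' `<=` K_il h i (l + 1) -> has_dim V''' r.+1 ->
    phi dd' dd'' @` V' = vanishing V'' (predC1 C3) ->
    phi dd'' dd' @` V'' = vanishing V' (pred1 C3) ->
    phi dd'' dd''' @` V'' = vanishing V''' (pred1 C2) ->
    phi dd''' dd'' @` V''' = vanishing V'' (predC1 C2) ->
    forall u v : 'I_(beta V'') -> sect X,
    complement_basis V'' u ->
    (forall j, K_il h i l (v j)) -> (forall j, phi dd dd'' (v j) = u j) ->
    let V := sum_space (sum_space (phi dd' dd @` V') (phi dd''' dd @` V'''))
               (lin_span v) in
    [/\ V `<=` K_il h i l, has_dim V r.+1,
    [/\ phi dd' dd @` V' = vanishing V (pred1 C2),
        phi dd dd' @` V = vanishing V' (predC1 C2),
        phi dd'' dd @` V'' = vanishing V (predC1 C1) &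
        phi dd dd'' @` V = vanishing V'' (pred1 C1)] &
        phi dd''' dd @` V''' = vanishing V (pred1 C3) /\
        phi dd dd''' @` V = vanishing V''' (predC1 C3)])
  /\
  (* 3 *)
  (forall i l : nat, (0 < i)%N -> (i < d)%N -> l = 0%N ->
    let dd := (i, d - i - l, l)%N in
    let dd'' := (i - 1, d - i - l + 1, l)%N in
    let dd''' := (i, d - i - l - 1, l + 1)%N in
    forall V'' V''' : set (sect X),
    V'' `<=` K_il h (i - 1) l -> has_dim V'' r.+1 ->
    V''' `<=` K_il h i (l + 1) -> has_dim V''' r.+1 ->
    phi dd'' dd''' @` V'' = vanishing V''' (pred1 C2) ->
    phi dd''' dd'' @` V''' = vanishing V'' (predC1 C2) ->
    forall u v : 'I_(beta V'') -> sect X,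
    complement_basis V'' u ->
    (forall j, K_il h i l (v j)) -> (forall j, phi dd dd'' (v j) = u j) ->
    let V := sum_space (phi dd''' dd @` V''') (lin_span v) in
    [/\ V `<=` K_il h i l, has_dim V r.+1 &
    [/\ phi dd''' dd @` V''' = vanishing V (pred1 C3),
        phi dd dd''' @` V = vanishing V''' (predC1 C3),
        phi dd'' dd @` V'' = vanishing V (predC1 C1) &
        phi dd dd'' @` V = vanishing V'' (pred1 C1)]]).
Proof.
have deg2 : deg (div2 L) = 0 by case: hL.
have sum_sub i l (W W' : set (sect X)) : (i <= d)%N -> (l <= d)%N ->
    W `<=` K_il h i l -> W' `<=` K_il h i l -> sum_space W W' `<=` K_il h i l.
  move=> id ld WK WK' _ [x /WK Kx [y /WK' Ky <-]].
  by apply: subspaceD => //; exact: K_il_subspace.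
have span_sub i l m (v : 'I_m -> sect X) : (i <= d)%N -> (l <= d)%N ->
    (forall j, K_il h i l (v j)) -> lin_span v `<=` K_il h i l.
  move=> id ld Kv _ [c ->]; have sK := K_il_subspace h id ld.
  by apply: subspace_sum => // j; exact: subspaceZ.
split; [|split].
- move=> [|i] [|l] // _ _ ild dd dd' dd'' V' V'' KV' dV' KV'' dV''.
  have -> : @phi k X dd' dd = restrict_extend (predC1 C2).
    by apply: phi_tilde; check_tilde.
  have -> : @phi k X dd dd' = restrict_extend (pred1 C2).
    by apply: phi_tildeV; check_tilde.
  have -> : @phi k X dd'' dd = restrict_extend (pred1 C1).
    by apply: phi_tildeV; check_tilde.
  have -> : @phi k X dd dd'' = restrict_extend (predC1 C1).
    by apply: phi_tilde; check_tilde.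
  have -> : @phi k X dd' dd'' = restrict_extend (pred1 C3).
    by apply: phi_tildeV; check_tilde.
  have -> : @phi k X dd'' dd' = restrict_extend (predC1 C3).
    by apply: phi_tilde; check_tilde.
  rewrite !subSS !subn0 in KV' KV'' *.
  move=> E1 E2 u v cu Kv vu V.
  (* a section of V'' supported on X_2 would have degree -1 after removing its
     zeros at A and B *)
  pose V''' := restrict_extend (predC1 C2) @` V''.
  have [sV' sV''] := (has_dim_subspace dV', has_dim_subspace dV'').
  have sV3 : is_subspace V''' by apply: image_subspace; case: sV''.
  have E4 : restrict_extend (pred1 C2) @` V''' = vanishing V'' (predC1 C2).
    apply: restricted_image_exactV => // -[[x y] z] Vs [x0 z0]; subst.
    rewrite (@K_il_supported2 _ _ _ _ _ _ h i l.+1 y) //; try lia.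
    exact: KV''.
  have [] := exact_extension sV' sV3 dV'' E1 E2 (restricted_image_exact _ _) E4 cu vu.
  rewrite [sum_space (_ @` V') _]sum_space_absorb -/V.
  + move=> dV [EV _]; split=> //; apply: (sum_sub); try lia; last first.
      by apply: span_sub => //; lia.
    by move=> _ [s /KV' Ks <-]; apply: K_il_restrict13 => //; lia.
  + by apply: image_subspace; case: sV'.
  + by exists 0; [case: sV3 | rewrite linear0].
  + move=> _ [_ [[[x y] z] Vs <-] <-]; exists (x, y, 0) => //.
    have : (restrict_extend (predC1 C3) @` V'') (x, y, 0) by exists (x, y, z).
    by rewrite E2 => -[].
- move=> [|i] [|l] // _ _ ild dd dd' dd'' dd''' V' V'' V'''.
  move=> KV' dV' KV'' dV'' KV3 dV3.
  have -> : @phi k X dd' dd = restrict_extend (predC1 C2).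
    by apply: phi_tilde; check_tilde.
  have -> : @phi k X dd dd' = restrict_extend (pred1 C2).
    by apply: phi_tildeV; check_tilde.
  have -> : @phi k X dd'' dd = restrict_extend (pred1 C1).
    by apply: phi_tildeV; check_tilde.
  have -> : @phi k X dd dd'' = restrict_extend (predC1 C1).
    by apply: phi_tilde; check_tilde.
  have -> : @phi k X dd' dd'' = restrict_extend (pred1 C3).
    by apply: phi_tildeV; check_tilde.
  have -> : @phi k X dd'' dd' = restrict_extend (predC1 C3).
    by apply: phi_tilde; check_tilde.
  have -> : @phi k X dd''' dd = restrict_extend (predC1 C3).
    by apply: phi_tilde; check_tilde.
  have -> : @phi k X dd dd''' = restrict_extend (pred1 C3).
    by apply: phi_tildeV; check_tilde.
  have -> : @phi k X dd'' dd''' = restrict_extend (predC1 C2).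
    by apply: phi_tilde; check_tilde.
  have -> : @phi k X dd''' dd'' = restrict_extend (pred1 C2).
    by apply: phi_tildeV; check_tilde.
  rewrite !subSS !subn0 addn1 in KV' KV'' KV3 *.
  move=> E1 E2 E3 E4 u v cu Kv vu V.
  have [sV' sV3] := (has_dim_subspace dV', has_dim_subspace dV3).
  have [dV [EV EV3]] := exact_extension sV' sV3 dV'' E1 E2 E3 E4 cu vu.
  split=> //; apply: (sum_sub); try lia; last by apply: span_sub => //; lia.
  apply: (sum_sub); try lia; move=> _ [s Vs <-].
    by apply: K_il_restrict13; [lia..|exact: KV'].
  by apply: K_il_restrict12; [lia..|exact: KV3].
- move=> [|i] _ // _ id -> dd dd'' dd''' V'' V''' KV'' dV'' KV3 dV3.
  have -> : @phi k X dd'' dd = restrict_extend (pred1 C1).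
    by apply: phi_tildeV; check_tilde.
  have -> : @phi k X dd dd'' = restrict_extend (predC1 C1).
    by apply: phi_tilde; check_tilde.
  have -> : @phi k X dd''' dd = restrict_extend (predC1 C3).
    by apply: phi_tilde; check_tilde.
  have -> : @phi k X dd dd''' = restrict_extend (pred1 C3).
    by apply: phi_tildeV; check_tilde.
  have -> : @phi k X dd'' dd''' = restrict_extend (predC1 C2).
    by apply: phi_tilde; check_tilde.
  have -> : @phi k X dd''' dd'' = restrict_extend (pred1 C2).
    by apply: phi_tildeV; check_tilde.
  rewrite !subSS !subn0 add0n in KV'' KV3 *.
  move=> E3 E4 u v cu Kv vu V.
  (* a section of V'' supported on X_3 would have vanishing order d + 1 or more
     at B *)
  pose V' := restrict_extend (predC1 C3) @` V''.
  have [sV3 sV''] := (has_dim_subspace dV3, has_dim_subspace dV'').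
  have sV' : is_subspace V' by apply: image_subspace; case: sV''.
  have E1 : restrict_extend (pred1 C3) @` V' = vanishing V'' (predC1 C3).
    apply: restricted_image_exactV => // -[[x y] z] Vs [x0 y0]; subst.
    rewrite (@K_i0_supported3 _ _ _ _ _ _ h i z) //; first lia.
    exact: KV''.
  have [] := exact_extension sV' sV3 dV'' E1 (restricted_image_exact _ _) E3 E4 cu vu.
  rewrite [sum_space (_ @` V') _]sum_spaceC [sum_space (_ @` V''') _]sum_space_absorb -/V.
  + move=> dV [[_ _ EV1 EV2] [EV3 EV4]]; split=> //; apply: (sum_sub); try lia; last first.
      by apply: span_sub => //; lia.
    by move=> _ [s /KV3 Ks <-]; apply: K_il_restrict12 => //; lia.
  + by apply: image_subspace; case: sV3.
  + by exists 0; [case: sV' | rewrite linear0].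
  + move=> _ [_ [[[x y] z] Vs <-] <-]; exists (x, 0, z) => //.
    have : (restrict_extend (predC1 C2) @` V'') (x, 0, z) by exists (x, y, z).
    by rewrite E3 => -[].
Qed.
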